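(* Let $n\ge 1$, $N\ge 2$, $q\in[0,1)$. Let $u,u_1$, $\mathbf v=(v_1,\dots,v_n)$ and $\mathbf s^{(v)}=(s_1,\dots,s_n)$ be arbitrary complex parameters for which all weights below are well defined. For $\eta\in\{0,1,\dots,n\}^N$ let $F(\eta)$ be the cylinder partition function with right boundary $\eta$ in which the vertex $(-m,j)$ carries the weight $w^{(-m)}_{s_m,z_{m,j}}$ with $$z_{m,1}=\frac{u_1}{v_m q^{1/2}},\qquad z_{m,j}=\frac{u}{v_m q^{1/2}}\quad (2\le j\le N),\qquad 1\le m\le n.$$ Let $\mathfrak T(u,u_1)$ be the twisted cylinder operator. Then for every $\eta'\in\{0,1,\dots,n\}^N$ $$\sum_{\eta\in\{0,\dots,n\}^N}F(\eta)\,\langle\eta|\,\mathfrak T(u,u_1)\,|\eta'\rangle=F(\eta').$$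
   Context: **Queue vertex weights with horizontal spin 1/2.** Colors are $1,\dots,n$; $0$ means ''no arrow''. Fix $1\le m\le n$. Let $\mathbf A,\mathbf C$ be $n$-tuples with $A_m=C_m=+\infty$ and all other coordinates in $\mathbb Z_{\ge0}$; $\mathbf e_i$ are standard basis vectors (adding or subtracting $\mathbf e_m$ changes nothing), $A_{[a,b]}=\sum_{i=a}^bA_i$ (zero if $a>b$). Let $k$ (color entering from the left) lie in $\{0\}\cup\{m+1,\dots,n\}$ and $\ell$ (color exiting to the right) in $\{0,1,\dots,n\}$. The weight $w^{(-m)}_{s,z}(\mathbf A,k;\mathbf C,\ell)$ ($\mathbf A$ enters from below, $\mathbf C$ exits above) equals $\frac1{1-sz}$ times: - $1$ for $(\mathbf A,0;\mathbf A,0)$ and for $(\mathbf A,k;\mathbf A+\mathbf e_k,0)$, $k>m$; - $-sz(1-q^{A_\ell})q^{A_{[\ell+1,n]}}$ for $(\mathbf A,0;\mathbf A-\mathbf e_\ell,\ell)$, $\ell>m$; - $-sz\,q^{A_{[m+1,n]}}$ for $(\mathbf A,0;\mathbf A,m)$; - $-s^2q^{A_{[m+1,n]}}$ for $(\mathbf A,k;\mathbf A+\mathbf e_k,m)$, $k>m$; - $-s(z-sq^{A_k})q^{A_{[k+1,n]}}$ for $(\mathbf A,k;\mathbf A,k)$, $k>m$; - $-sz(1-q^{A_\ell})q^{A_{[\ell+1,n]}}$ for $(\mathbf A,k;\mathbf A+\mathbf e_k-\mathbf e_\ell,\ell)$, $m<k<\ell$; - $-s^2(1-q^{A_\ell})q^{A_{[\ell+1,n]}}$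 for $(\mathbf A,k;\mathbf A+\mathbf e_k-\mathbf e_\ell,\ell)$, $m<\ell<k$; and all other weights are $0$. **Cylinder partition function.** The vertices are $(-m,j)$, $1\le m\le n$, $j\in\mathbb Z/N\mathbb Z$. For $\eta=(\eta_1,\dots,\eta_N)\in\{0,\dots,n\}^N$ in which every color $1,\dots,n$ occurs at least once, the partition function with right boundary $\eta$ is $$\sum\ \prod_{m=1}^n\prod_{j=1}^N w_{m,j}\bigl(\mathbf A^{(m,j)},h_{m+1,j};\mathbf A^{(m,j+1)},h_{m,j}\bigr),$$ where $w_{m,j}$ is the weight at $(-m,j)$, and the sum is over all $h_{m,j}\in\{0,\dots,n\}$ with $h_{n+1,j}=0$, $h_{1,j}=\eta_j$, and over all vertical tuples $\mathbf A^{(m,j)}$, with index $j$ cyclic mod $N$ (so $\mathbf A^{(m,N+1)}=\mathbf A^{(m,1)}$), such that $(\mathbf A^{(m,j)})_m=+\infty$, $(\mathbf A^{(m,j)})_i=0$ for $i<m$, $(\mathbf A^{(m,j)})_i\in\mathbb Z_{\ge0}$ for $i>m$. (The sum converges.) If some color in $\{1,\dots,n\}$ is missing from $\eta$, the partition function is set to $0$. For $q=0$ the quantities $z_{m,j}$ are regarded as the parameters. **R-matrix.** For $i,j\in\{0,\dots,n\}$, $i<j$: $R_z(i,i;i,i)=1$, $R_z(j,i;j,i)=\frac{q(1-z)}{1-qz}$, $R_z(i,j;i,j)=\frac{1-z}{1-qz}$, $R_z(j,i;i,j)=\frac{1-q}{1-qz}$, $R_z(i,j;j,i)=\frac{(1-q)z}{1-qz}$;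 all other entries vanish. The operator $\check{\mathscr R}_z$ on $\mathbb C^{n+1}\otimes\mathbb C^{n+1}$ has matrix elements $\langle i,j|\check{\mathscr R}_z|\ell,k\rangle=R_z(i,j;k,\ell)$; $\check{\mathscr R}^{(ab)}_z$ is $\check{\mathscr R}_z$ acting on tensor factors $a$ (first) and $b$ (second) of $(\mathbb C^{n+1})^{\otimes N}$, with basis $|\eta\rangle$. **Twisted cylinder operator.** $\mathfrak T(u,u_1)=\check{\mathscr R}^{(12)}_{u_1/u}\check{\mathscr R}^{(23)}_{u_1/u}\cdots\check{\mathscr R}^{(N-1,N)}_{u_1/u}\check{\mathscr R}^{(N1)}_{u_1/u}$, operators acting on row vectors (so the leftmost factor acts first). *)

(* Defs.v *)
From HB Require Import structures.
From mathcomp Require Import all_boot all_order all_algebra.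
From mathcomp Require Import finmap complex.
From mathcomp Require Import all_classical all_reals topology normedtype.
From mathcomp Require Import summability.

Set Implicit Arguments.
Unset Strict Implicit.
Unset Printing Implicit Defensive.

Import Order.TTheory GRing.Theory Num.Theory.
Import numFieldNormedType.Exports.

Local Open Scope ring_scope.
Local Open Scope complex_scope.

(* Colors are 0, ..., n (0 = no arrow).  In an n-tuple the coordinate i : 'I_n
   belongs to color i.+1, and None stands for +oo. *)
Definition vtuple (n : nat) := {ffun 'I_n -> option nat}.

(* A + e_k and A - e_k, with e_0 = 0 and +oo + 1 = +oo - 1 = +oo.  The
   subtraction is truncated, but in the weights below A - e_l always comes with
   the factor 1 - q ^ A_l, which vanishes when A_l = 0. *)
Definition vadd n (A : vtuple n) (k : nat) : vtuple n :=
  [ffun i : 'I_n => if i.+1 == k then omap succn (A i) else A i].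

Definition vsub n (A : vtuple n) (k : nat) : vtuple n :=
  [ffun i : 'I_n => if i.+1 == k then omap predn (A i) else A i].

(* A_{[a,b]}, with colors numbered from 1.  It is only used at column -m with
   a > m, where all the entries are finite. *)
Definition vsum n (A : vtuple n) (a b : nat) : nat :=
  (\sum_(i < n | a <= i.+1 <= b) odflt 0 (A i))%N.

Definition ventry n (A : vtuple n) (a : nat) : nat := vsum A a a.

(* The weight w^{(-m)}_{s,z}(A, k; B, l).  In every case listed in the
   definition of the weights, B = A + e_k - e_l (recall that e_m has no effect);
   for l > m, the case k = 0 has the same formula as the case m < k < l. *)
Definition queue_weight (K : fieldType) n (q s z : K) (m : nat)
    (A : vtuple n) (k : nat) (B : vtuple n) (l : nat) : K :=
  (1 - s * z)^-1 *
  (if ~~ ((k == 0%N) || (m < k)%N) then 0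
   else if B != vsub (vadd A k) l then 0
   else if l == 0%N then 1
   else if (l < m)%N then 0
   else if l == m then
     if k == 0%N then - (s * z * q ^+ vsum A m.+1 n)
     else - (s ^+ 2 * q ^+ vsum A m.+1 n)
   else if l == k then
     - (s * (z - s * q ^+ ventry A k) * q ^+ vsum A k.+1 n)
   else if (k < l)%N then
     - (s * z * (1 - q ^+ ventry A l) * q ^+ vsum A l.+1 n)
   else - (s ^+ 2 * (1 - q ^+ ventry A l) * q ^+ vsum A l.+1 n)).

Definition boundary (n N : nat) := {ffun 'I_N -> 'I_n.+1}.

(* A pair (h, A) with h (i, j) = h_{i+1, j+1} for i = 0, ..., n and
   A (m, j) = A^{(m+1, j+1)} for m = 0, ..., n-1. *)
Definition config (n N : nat) : choiceType :=
  ({ffun 'I_n.+1 * 'I_N -> 'I_n.+1} * {ffun 'I_n * 'I_N -> vtuple n})%type.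

Definition admissible n N (eta : boundary n N) (c : config n N) : bool :=
  [&& [forall j, c.1 (ord_max, j) == ord0],
      [forall j, c.1 (ord0, j) == eta j] &
      [forall m : 'I_n, forall j : 'I_N, forall i : 'I_n,
        if (i < m)%N then c.2 (m, j) i == Some 0%N
        else if i == m then c.2 (m, j) i == None
        else c.2 (m, j) i != None]].

(* widen_ord (leqnSn n) m and lift ord0 m are m and m + 1 in 'I_n.+1, and ordS
   is the cyclic successor in 'I_N. *)
Definition config_weight (K : fieldType) n N (q : K) (s : 'I_n -> K)
    (z : 'I_n -> 'I_N -> K) (c : config n N) : K :=
  \prod_(m < n) \prod_(j < N)
    queue_weight q (s m) (z m j) m.+1
      (c.2 (m, j)) (c.1 (lift ord0 m, j))
      (c.2 (m, ordS j)) (c.1 (widen_ord (leqnSn n) m, j)).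

Definition all_colors n N (eta : boundary n N) : bool :=
  [forall c : 'I_n, exists j, eta j == lift ord0 c].

(* summability.sum is the unordered sum: the limit of the finite partial sums
   along the directed set of finite subsets of the index type. *)
Definition cylinder_partition (R : realType) n N (q : R[i]) (s : 'I_n -> R[i])
    (z : 'I_n -> 'I_N -> R[i]) (eta : boundary n N) : R[i] :=
  if all_colors eta then
    summability.sum (fun c : config n N =>
      (if admissible eta c then config_weight q s z c else 0) : R[i]^o)
  else 0.

Definition Rmat (K : fieldType) n (q z : K) (a b c d : 'I_n.+1) : K :=
  if a == b then if (c == a) && (d == a) then 1 else 0
  else if (c == a) && (d == b) then
    if (b < a)%N then q * (1 - z) / (1 - q * z) else (1 - z) / (1 - q * z)
  else if (c == b) && (d == a) then
    if (b < a)%N then (1 - q) / (1 - q * z) else (1 - q) * z / (1 - q * z)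
  else 0.

(* Operators on (C^{n+1})^{(x) N} in the basis |eta>, acting on row vectors. *)
Definition tensor_op (K : fieldType) (n N : nat) := 'M[K]_#|{: boundary n N}|.

Definition matelt (K : fieldType) n N (M : tensor_op K n N)
    (eta eta' : boundary n N) : K := M (enum_rank eta) (enum_rank eta').

(* \check R_z on the tensor factors a (first) and b (second), a <> b:
   <i, j| \check R_z |l, k> = R_z(i, j; k, l). *)
Definition Rcheck (K : fieldType) n N (q z : K) (a b : 'I_N) :
    tensor_op K n N :=
  \matrix_(x, y)
    let eta : boundary n N := enum_val x in
    let eta' : boundary n N := enum_val y in
    if [forall c, (c != a) && (c != b) ==> (eta c == eta' c)]
    then Rmat q z (eta a) (eta b) (eta' b) (eta' a) else 0.

(* The ordered product of the N factors (12), (23), ..., (N-1 N), (N1). *)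
Definition twisted_cylinder (K : fieldType) n N (q u u1 : K) :
    tensor_op K n N :=
  \big[mulmx/1%:M]_(j < N) Rcheck n q (u1 / u) j (ordS j).

Definition row_param (K : fieldType) N (u u1 : K) (j : 'I_N) : K :=
  if j == 0%N :> nat then u1 else u.

(* z_{m,1} = u1 / (v_m q^{1/2}) and z_{m,j} = u / (v_m q^{1/2}) for j >= 2.
   For q = 0 the z_{m,j} are themselves the parameters, and only the
   proportions z_{m,1} : z_{m,2} : ... : z_{m,N} = u1 : u : ... : u remain. *)
Definition twisted_spectral (R : realType) n N (q : R) (u u1 : R[i])
    (v : 'I_n -> R[i]) (z : 'I_n -> 'I_N -> R[i]) : Prop :=
  if q == 0 then
    forall m, exists x, forall j, z m j = row_param u u1 j * x
  else
    forall m j, z m j = row_param u u1 j / (v m * (Num.sqrt q)%:C).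

(* Main.v *)
(* The partition function is the trace of a product of row operators, one for
   each row of the cylinder.  The Yang-Baxter equation in each column, together
   with the triviality of the R-matrix on a pair of empty edges entering from
   the left, shows that applying the R-matrix to the right boundary of two
   adjacent rows exchanges their spectral parameters.  The factors of the
   twisted cylinder operator thus carry the distinguished parameter u1 once
   around the cylinder, back to the first row.  The intermediate vertical state
   between the two rows is determined by the rest of the configuration, so each
   exchange is an equality of finite sums over blocks of configurations; it
   extends to the full sums because these converge absolutely: when every color
   occurs, each column m emits its own color somewhere, at the cost of a factor
   q ^ A_[m+1,n]. *)
Require Import Defs.
From HB Require Import structures.
From mathcomp Require Import all_boot all_fingroup all_order all_algebra fraction.
From mathcomp Require Import finmap complex ring zify.
From mathcomp Require Import all_classical all_reals topology normedtype.
From mathcomp Require Import summability.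

Set Implicit Arguments.
Unset Strict Implicit.
Unset Printing Implicit Defensive.

Import Order.TTheory GRing.Theory Num.Theory.
Import numFieldNormedType.Exports.

Local Open Scope ring_scope.
Local Open Scope complex_scope.

(** * The Yang-Baxter equation for one column *)

(* With T x = q ^ A_[x,n] for x > m and T x = 0 for x <= m (as A_m = +oo), all
   the weights at column m are given by this one formula, up to the factor
   1 / (1 - s z); it also vanishes when 0 < l < m. *)
Definition tail_num (K : pzRingType) (s z : K) (T : nat -> K) (k l : nat) : K :=
  if l == 0%N then 1
  else - (s * ((if (k <= l)%N then z else s) * T l.+1
               - (if (k < l)%N then z else s) * T l)).

(* stay_num and swap_num are (1 - q z) R_z(a, b; b, a) and
   (1 - q z) R_z(a, b; a, b), the weights of \check R_z for (a, b) -> (a, b) and,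
   if a <> b, for (a, b) -> (b, a). *)
Definition stay_num (K : pzRingType) (q z : K) (a b : nat) : K :=
  if a == b then 1 - q * z else if (b < a)%N then 1 - q else (1 - q) * z.

Definition swap_num (K : pzRingType) (q z : K) (a b : nat) : K :=
  if a == b then 0 else if (b < a)%N then q * (1 - z) else 1 - z.

(* The effect on T of replacing A with A + e_k - e_l. *)
Definition tail_shift (K : fieldType) (q : K) (T : nat -> K) (k l x : nat) : K :=
  T x * (if (x <= k)%N then q else 1) / (if (x <= l)%N then q else 1).

(** The values of [T] act as free variables: once the relative order of the colors is fixed, every
    [if] resolves and a rational identity remains. [q != 0] is due to the division in
    [tail_shift]. *)
Lemma tail_yang_baxter (K : fieldType) (q s x z : K) (T : nat -> K)
    (k1 k2 l1 l2 : nat) : q != 0 ->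
  tail_num s (x * z) T k1 l1 * tail_num s z (tail_shift q T k1 l1) k2 l2
    * stay_num q x l1 l2
  + tail_num s (x * z) T k1 l2 * tail_num s z (tail_shift q T k1 l2) k2 l1
    * swap_num q x l2 l1
  = stay_num q x k1 k2 * (tail_num s z T k1 l1
      * tail_num s (x * z) (tail_shift q T k1 l1) k2 l2)
  + swap_num q x k1 k2 * (tail_num s z T k2 l1
      * tail_num s (x * z) (tail_shift q T k2 l1) k1 l2).
Proof.
move=> q0; rewrite /tail_num /stay_num /swap_num /tail_shift.
case: l1 l2 => [|l1] [|l2] /=.
- by case: (ltngtP k1 k2) => *; ring.
- case: (ltngtP k1 k2) => [?|?|->];
    case: (ltngtP k1 l2.+1) => ?; try lia;
    case: (ltngtP k2 l2.+1) => ?; try lia; field; rewrite ?q0 ?oner_eq0 //.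
- case: (ltngtP k1 k2) => [?|?|->];
    case: (ltngtP k1 l1.+1) => ?; try lia;
    case: (ltngtP k2 l1.+1) => ?; try lia; field; rewrite ?q0 ?oner_eq0 //.
- case: (ltngtP l1.+1 l2.+1) => [?|?|[<-]]; case: (ltngtP k1 k2) => [?|?|->];
    case: (ltngtP k1 l1.+1) => ?; try lia;
    case: (ltngtP k2 l1.+1) => ?; try lia;
    rewrite ?leqnn ?ltnn ?eqxx;
    try (case: (ltngtP k1 l2.+1) => ?; try lia);
    try (case: (ltngtP k2 l2.+1) => ?; try lia);
    try (field; rewrite ?q0 ?oner_eq0 //).
Qed.

(** * Vertical states of a column and the closed form of the weights *)

Definition column_tuple n (m : 'I_n) (A : vtuple n) : bool :=
  [forall i : 'I_n,
    if (i < m)%N then A i == Some 0%N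
    else if i == m then A i == None
    else A i != None].

Lemma column_tupleP n (m : 'I_n) (A : vtuple n) :
  reflect [/\ forall i : 'I_n, (i < m)%N -> A i = Some 0%N, A m = None
            & forall i : 'I_n, (m < i)%N -> A i != None] (column_tuple m A).
Proof.
apply: (iffP forallP) => [H|[H1 H2 H3] i].
  split=> [i im||i im]; first by have := H i; rewrite im => /eqP.
    by have := H m; rewrite ltnn eqxx => /eqP.
  by have := H i; rewrite -val_eqE /= ltnNge (ltnW im) /= gtn_eqF.
rewrite -val_eqE; case: ltngtP => [im|im|/val_inj ->]; first by rewrite H1.
  by rewrite H3.
by rewrite H2.
Qed.

Lemma vaddK n (A : vtuple n) k : vsub (vadd A k) k = A.
Proof. by apply/ffunP => i; rewrite !ffunE; case: eqP => // _; case: (A i). Qed.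

Lemma vadd_inj n k : injective (fun A : vtuple n => vadd A k).
Proof. by apply: (can_inj (g := fun A => vsub A k)) => A; apply: vaddK. Qed.

Lemma vaddAC n (A : vtuple n) k l : vadd (vadd A k) l = vadd (vadd A l) k.
Proof.
apply/ffunP => i; rewrite !ffunE.
by case: (_ == k); case: (_ == l).
Qed.

Lemma vsubK n (A : vtuple n) l :
  (forall i : 'I_n, i.+1 = l -> A i != Some 0%N) -> vadd (vsub A l) l = A.
Proof.
move=> H; apply/ffunP => i; rewrite !ffunE; case: eqP => // /H.
by case: (A i) => [[]|].
Qed.

Lemma vsum_recl n (A : vtuple n) (i : 'I_n) :
  vsum A i.+1 n = (odflt 0 (A i) + vsum A i.+2 n)%N.
Proof.
rewrite /vsum (bigD1 i) /=; last by rewrite leqnn ltn_ord.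
congr (_ + _)%N; apply: eq_bigl => j.
by rewrite -val_eqE /= ltnS; apply/idP/idP; lia.
Qed.

Lemma ventry_ord n (A : vtuple n) (i : 'I_n) : ventry A i.+1 = odflt 0%N (A i).
Proof.
rewrite /ventry /vsum (big_pred1 i) // => j.
by rewrite /= -val_eqE /= -eqn_leq eqSS eq_sym.
Qed.

Lemma vsum_vadd n (A : vtuple n) k x : (0 < x)%N -> (k <= n)%N ->
  (forall i : 'I_n, (x <= i.+1)%N -> A i != None) ->
  vsum (vadd A k) x n = ((x <= k) + vsum A x n)%N.
Proof.
move=> x0 kn fin; rewrite /vsum.
transitivity (\sum_(i < n | (x <= i.+1 <= n)%N)
    ((i.+1 == k) + odflt 0%N (A i)))%N.
  apply: eq_bigr => i /andP[xi _]; rewrite !ffunE; case: eqP => // _.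
  by have := fin i xi; case: (A i).
rewrite big_split /=; congr (_ + _)%N; rewrite -big_mkcondr /= sum1_card.
case: leqP => xk.
  have k0 : (k.-1 < n)%N by lia.
  rewrite (eq_card (B := pred1 (Ordinal k0))) ?card1 // => i.
  by rewrite !inE -val_eqE /=; apply/idP/idP; lia.
by apply: eq_card0 => i; rewrite !inE; apply/negP; lia.
Qed.

(** The [T] of [tail_num] for column [m : 'I_n], whose own color is [m.+1]. The value 0 stands for
    [q] to an infinite power: the interval then contains the infinite coordinate. *)
Definition tail_pow (K : pzRingType) n (q : K) (m : 'I_n) (A : vtuple n) (x : nat) : K :=
  if (x <= m.+1)%N then 0 else q ^+ vsum A x n.

(** Conservation is stated additively, which avoids truncated subtraction; without division, the
    formula commutes with ring morphisms. *)
Definition queue_num (K : pzRingType) n (q s z : K) (m : 'I_n)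
    (A : vtuple n) (k : nat) (B : vtuple n) (l : nat) : K :=
  if ((k == 0%N) || (m.+1 < k)%N) && (vadd B l == vadd A k)
  then tail_num s z (tail_pow q m A) k l else 0.

Lemma queue_num_rmorph (K L : pzRingType) (f : {rmorphism K -> L}) n (q s z : K)
    (m : 'I_n) A k B l :
  f (queue_num q s z m A k B l) = queue_num (f q) (f s) (f z) m A k B l.
Proof.
rewrite /queue_num /tail_num /tail_pow; case: ifP => _; last exact: rmorph0.
case: ifP => _; first exact: rmorph1.
by rewrite rmorphN rmorphM rmorphB !rmorphM !(fun_if f) !rmorphXn rmorph0.
Qed.

(* The truncation in vsub only matters where the weight vanishes. *)
Lemma vsub_queue (K : comNzRingType) n (q s z : K) (m : 'I_n) A k B l :
  column_tuple m A -> (l <= n)%N ->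
  (B == vsub (vadd A k) l) = (vadd B l == vadd A k)
  \/ tail_num s z (tail_pow q m A) k l = 0.
Proof.
move=> /column_tupleP[A0 Am Af] ln.
case: (boolP (vadd (vsub (vadd A k) l) l == vadd A k)) => [/eqP e|ne].
  left; apply/eqP/eqP => [->//|<-]; by rewrite vaddK.
right.
have [i il Ai] : exists2 i : 'I_n, i.+1 = l & vadd A k i = Some 0%N.
  case: (boolP [exists i : 'I_n, (i.+1 == l) && (vadd A k i == Some 0%N)]).
    by case/existsP => i /andP[/eqP ? /eqP ?]; exists i.
  move=> /existsPn H; case/eqP: ne; apply: vsubK => i il.
  by have := H i; rewrite il eqxx.
move: Ai; rewrite !ffunE -il; case: (eqVneq i.+1 k) => [_|ik Ai].
  by case: (A i).
rewrite /tail_num /=; apply/eqP; rewrite oppr_eq0.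
have -> : (k <= i.+1)%N = (k < i.+1)%N by rewrite leq_eqVlt eq_sym (negbTE ik).
rewrite -mulrBr; suff -> : tail_pow q m A i.+2 = tail_pow q m A i.+1.
  by rewrite subrr !mulr0.
rewrite /tail_pow (vsum_recl A i) Ai /=.
have im : i != m by apply/eqP => e; rewrite e Am in Ai.
by rewrite !ltnS ltn_neqAle val_eqE im.
Qed.

(** Below the own color both tails vanish; at it [T l = 0]; above it [T l = q ^ A_l * T l.+1].
    Substituted in [tail_num], these give the listed weights. *)
Lemma queue_weightE (K : fieldType) n (q s z : K) (m : 'I_n) A k B l :
  column_tuple m A -> (k <= n)%N -> (l <= n)%N ->
  queue_weight q s z m.+1 A k B l = (1 - s * z)^-1 * queue_num q s z m A k B l.
Proof.
move=> Ac kn ln; rewrite /queue_weight; congr (_ * _).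
have tk (i : 'I_n) : (m < i)%N ->
    tail_pow q m A i.+1 = q ^+ ventry A i.+1 * q ^+ vsum A i.+2 n.
  by move=> mi; rewrite /tail_pow ltnS leqNgt mi /= vsum_recl exprD ventry_ord.
rewrite /queue_num; case: ifP => /= kok; first by rewrite (negbTE kok).
move/negbFE: kok => kok; rewrite kok /=.
set body := (X in (if _ then _ else X) = _).
have -> : body = tail_num s z (tail_pow q m A) k l.
  rewrite /body /tail_num; case: eqP => // /eqP l0.
  case: ltngtP => [lm|ml|->].
  - by rewrite /tail_pow lm (ltnW lm) !mulr0 subrr mulr0 oppr0.
  - have ll : (l.-1 < n)%N by lia.
    have el : (Ordinal ll).+1 = l by rewrite /= prednK // lt0n.
    have := tk (Ordinal ll); rewrite el => -> /=; last by lia.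
    rewrite (_ : tail_pow q m A l.+1 = q ^+ vsum A l.+1 n); last first.
      by rewrite /tail_pow ltnNge (ltnW ml).
    by rewrite eq_sym; case: ltngtP => [kl|kl|->]; ring.
  - have -> : tail_pow q m A m.+1 = 0 by rewrite /tail_pow leqnn.
    have -> : tail_pow q m A m.+2 = q ^+ vsum A m.+2 n by rewrite /tail_pow ltnn.
    rewrite mulr0 subr0.
    case: eqP kok => [->//|_ /= mk]; first by rewrite mulrA.
    by rewrite leqNgt mk /=; ring.
case: (@vsub_queue _ _ q s z m A k B l Ac ln) => [<-|->].
  by case: ifP => //; rewrite -if_neg => ->.
by rewrite !if_same.
Qed.

(** A color below the own one cannot enter, and cannot leave because both tails vanish; so zero
    coordinates stay zero. *)
Lemma queue_num_column (K : pzRingType) n (q s z : K) (m : 'I_n) A k B l :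
  column_tuple m A -> queue_num q s z m A k B l != 0 -> column_tuple m B.
Proof.
move=> /column_tupleP[A0 Am Af]; rewrite /queue_num.
case: ifP => [/andP[kok /eqP e]|]; last by rewrite eqxx.
rewrite /tail_num; case: (eqVneq l 0%N) => [l0|l0] nz.
  apply/column_tupleP; split=> [i im||i im]; move/ffunP: e => e.
  - by have := e i; rewrite l0 !ffunE /= A0 //; case: eqP => // ?; lia.
  - by have := e m; rewrite l0 !ffunE /= Am if_same.
  - by have := e i; have := Af i im; rewrite l0 !ffunE /=; case: (A i) => // a _;
      case: ifP => _ ->.
have ml : (m < l)%N.
  rewrite ltnNge; apply: contraNN nz => lm.
  by rewrite /tail_pow ltnS lm (leqW lm) !mulr0 subrr mulr0 oppr0.
move/ffunP: e => e; apply/column_tupleP; split=> [i im||i im].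
- have := e i; rewrite !ffunE A0 //; case: eqP => [|_]; first by lia.
  by case: eqP => // ?; lia.
- by have := e m; rewrite !ffunE Am if_same; case: ifP => //; case: (B m).
- have := e i; have := Af i im; rewrite !ffunE; case: (A i) => // a _.
  by case: (B i) => //=; rewrite !if_same; case: ifP.
Qed.

(** Conservation changes the exponent by [[x <= k] - [x <= l]]; a negative change requires [q]
    invertible. *)
Lemma tail_pow_shift (K : fieldType) n (q : K) (m : 'I_n) A k B l x :
  q != 0 -> column_tuple m A -> column_tuple m B -> (k <= n)%N -> (l <= n)%N ->
  vadd B l = vadd A k ->
  tail_pow q m B x = tail_shift q (tail_pow q m A) k l x.
Proof.
move=> q0 /column_tupleP[_ _ Af] /column_tupleP[_ _ Bf] kn ln e.
rewrite /tail_shift /tail_pow; case: leqP => mx; first by rewrite !mul0r.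
have x0 : (0 < x)%N by lia.
have fin (C : vtuple n) : (forall i : 'I_n, (m < i)%N -> C i != None) ->
    forall i : 'I_n, (x <= i.+1)%N -> C i != None.
  by move=> Cf i xi; apply: Cf; lia.
have := vsum_vadd x0 ln (fin B Bf); rewrite e (vsum_vadd x0 kn (fin A Af)) => ee.
apply: (canRL (mulfK _)); first by case: ifP; rewrite ?oner_eq0.
have pb (b : bool) : (if b then q else 1) = q ^+ b by case: b.
by rewrite !pb -!exprD; congr (q ^+ _); rewrite addnC -ee addnC.
Qed.

(** Two consecutive vertices of one column. Conservation forces the state between them, so there is
    no sum over it. *)
Definition pair_num (K : pzRingType) n (q s z z' : K) (m : 'I_n) (A C : vtuple n)
    (k1 k2 l1 l2 : nat) : K :=
  queue_num q s z m A k1 (vsub (vadd A k1) l1) l1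
  * queue_num q s z' m (vsub (vadd A k1) l1) k2 C l2.

Lemma pair_num_rmorph (K L : pzRingType) (f : {rmorphism K -> L}) n
    (q s z z' : K) (m : 'I_n) A C k1 k2 l1 l2 :
  f (pair_num q s z z' m A C k1 k2 l1 l2)
  = pair_num (f q) (f s) (f z) (f z') m A C k1 k2 l1 l2.
Proof. by rewrite rmorphM !queue_num_rmorph. Qed.

Lemma stay_num_rmorph (K L : pzRingType) (f : {rmorphism K -> L}) (q z : K) a b :
  f (stay_num q z a b) = stay_num (f q) (f z) a b.
Proof.
rewrite /stay_num; case: ifP => _; first by rewrite rmorphB rmorphM rmorph1.
by case: ifP => _; rewrite ?rmorphM rmorphB rmorph1.
Qed.

Lemma swap_num_rmorph (K L : pzRingType) (f : {rmorphism K -> L}) (q z : K) a b :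
  f (swap_num q z a b) = swap_num (f q) (f z) a b.
Proof.
rewrite /swap_num; case: ifP => _; first by rewrite rmorph0.
by case: ifP => _; rewrite ?rmorphM rmorphB rmorph1.
Qed.

(** Eliminates the intermediate state. The remaining condition is symmetric in [k1], [k2] and in
    [l1], [l2], hence common to all four terms of the Yang-Baxter equation, which reduces to the one
    for tails. *)
Lemma pair_numE (K : fieldType) n (q s z z' : K) (m : 'I_n) A C k1 k2 l1 l2 :
  q != 0 -> column_tuple m A ->
  (k1 <= n)%N -> (k2 <= n)%N -> (l1 <= n)%N -> (l2 <= n)%N ->
  pair_num q s z z' m A C k1 k2 l1 l2 =
  if [&& (k1 == 0%N) || (m.+1 < k1)%N, (k2 == 0%N) || (m.+1 < k2)%N
       & vadd (vadd C l1) l2 == vadd (vadd A k1) k2]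
  then tail_num s z (tail_pow q m A) k1 l1
       * tail_num s z' (tail_shift q (tail_pow q m A) k1 l1) k2 l2
  else 0.
Proof.
move=> q0 Ac k1n k2n l1n l2n; rewrite /pair_num.
set B := vsub _ _.
case: (@vsub_queue _ _ q s z m A k1 B l1 Ac l1n); last first.
  by move=> t0; rewrite /queue_num t0 if_same !mul0r if_same.
rewrite {1}/B eqxx => /esym/eqP e.
case: (eqVneq (queue_num q s z m A k1 B l1) 0) => [q0'|nz].
  rewrite q0' mul0r; move: q0'; rewrite /queue_num e eqxx andbT.
  by case: ifP => //= _ ->; rewrite mul0r if_same.
have Bc := queue_num_column Ac nz.
have -> : (vadd (vadd C l1) l2 == vadd (vadd A k1) k2) = (vadd C l2 == vadd B k2).
  by rewrite vaddAC -e (vaddAC B) (inj_eq (@vadd_inj _ l1)).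
rewrite {1}/queue_num e eqxx andbT; case: ifP => //= _; last by rewrite mul0r.
rewrite /queue_num; case: ifP => //= _; last by rewrite mulr0.
by rewrite {2 3}/tail_num !(tail_pow_shift _ q0 Ac Bc k1n l1n e).
Qed.

Lemma pair_num_yang_baxter (K : fieldType) n (q s x z : K) (m : 'I_n) A C
    k1 k2 l1 l2 : column_tuple m A ->
  (k1 <= n)%N -> (k2 <= n)%N -> (l1 <= n)%N -> (l2 <= n)%N ->
  pair_num q s (x * z) z m A C k1 k2 l1 l2 * stay_num q x l1 l2
  + pair_num q s (x * z) z m A C k1 k2 l2 l1 * swap_num q x l2 l1
  = stay_num q x k1 k2 * pair_num q s z (x * z) m A C k1 k2 l1 l2
  + swap_num q x k1 k2 * pair_num q s z (x * z) m A C k2 k1 l1 l2.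
Proof.
move=> Ac k1n k2n l1n l2n.
have generic (L : fieldType) (q' s' x' z' : L) : q' != 0 ->
    pair_num q' s' (x' * z') z' m A C k1 k2 l1 l2 * stay_num q' x' l1 l2
    + pair_num q' s' (x' * z') z' m A C k1 k2 l2 l1 * swap_num q' x' l2 l1
    = stay_num q' x' k1 k2 * pair_num q' s' z' (x' * z') m A C k1 k2 l1 l2
    + swap_num q' x' k1 k2 * pair_num q' s' z' (x' * z') m A C k2 k1 l1 l2.
  move=> q0; rewrite !pair_numE // (vaddAC _ l2 l1) (vaddAC _ k2 k1).
  case: (_ || _); case: (_ || _); rewrite /= ?mul0r ?mulr0 //.
  case: eqP => _; last by rewrite !mul0r !mulr0.
  exact: tail_yang_baxter.
(* tail_shift divides by q, but both sides are polynomials in q: the case q = 0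
   is a specialization of the identity over the field of fractions of K[X]. *)
have := generic {fraction {poly K}} (tofrac 'X) (tofrac s%:P) (tofrac x%:P)
  (tofrac z%:P).
rewrite tofrac_eq0 polyX_eq0 => /(_ isT).
rewrite -!rmorphM -!pair_num_rmorph -!stay_num_rmorph -!swap_num_rmorph.
rewrite -!rmorphM -!rmorphD => /eqP; rewrite tofrac_eq => /eqP /(congr1 (horner_eval q)).
rewrite /pair_num !rmorphD !rmorphM !queue_num_rmorph !stay_num_rmorph !swap_num_rmorph.
by rewrite !rmorphM /= /horner_eval !hornerE.
Qed.

(** * The R-matrix on pairs of colors *)

Lemma RmatE (K : fieldType) n (q x : K) (a b c d : 'I_n.+1) : 1 - q * x != 0 ->
  Rmat q x a b d c = (1 - q * x)^-1 *
    (stay_num q x a b * ((c, d) == (a, b))%:R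
     + swap_num q x a b * ((c, d) == (b, a))%:R).
Proof.
move=> qx; rewrite /Rmat /stay_num /swap_num !xpair_eqE !val_eqE.
case: (eqVneq a b) => [<-|ab].
  by rewrite mul0r addr0 andbC; case: andP => _; rewrite ?mulr0 // mulr1 mulVf.
case: (eqVneq c b) => [->|cb].
  rewrite [b == a]eq_sym (negbTE ab) /= andbT.
  case: (eqVneq d a) => [_|da] /=; last by rewrite andbF !mulr0 addr0 mulr0.
  by rewrite mulr0 add0r mulr1; case: ifP => _; rewrite mulrC.
rewrite andbF /= mulr0 addr0 andbC.
case: (_ && _); last by rewrite !mulr0.
by rewrite mulr1; case: ifP => _; rewrite mulrC.
Qed.

(** Only [c] and its transpose lead to [c]; the order [c.2 c.1] is the convention of \check R. If
    both colors agree, [swap_num] is 0, so nothing is counted twice. *)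
Lemma Rmat_suml (K : fieldType) n (q x : K) (f : 'I_n.+1 * 'I_n.+1 -> K)
    (c : 'I_n.+1 * 'I_n.+1) : 1 - q * x != 0 ->
  \sum_b f b * Rmat q x b.1 b.2 c.2 c.1 = (1 - q * x)^-1 *
    (f c * stay_num q x c.1 c.2 + f (c.2, c.1) * swap_num q x c.2 c.1).
Proof.
move=> qx.
pose g (b e : 'I_n.+1 * 'I_n.+1) (h : K) := if b == e then h else 0.
transitivity (\sum_b (1 - q * x)^-1 *
    (g b c (f c * stay_num q x c.1 c.2)
     + g b (c.2, c.1) (f (c.2, c.1) * swap_num q x c.2 c.1))).
  apply: eq_bigr => -[b1 b2] _; rewrite RmatE //= mulrCA mulrDr; congr (_ * _).
  case: c => c1 c2; rewrite /g /= (eq_sym (c1, c2)) !xpair_eqE.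
  rewrite [(c1 == b2)]eq_sym [(c2 == b1)]eq_sym [(b2 == c1) && _]andbC.
  congr (_ + _); case: andP => [[/eqP-> /eqP->]|_]; by rewrite ?mulr1 ?mulr0.
rewrite -mulr_sumr big_split /=; congr (_ * (_ + _));
by rewrite -big_mkcond /= big_pred1_eq.
Qed.

Lemma Rmat_sumr (K : fieldType) n (q x : K) (f : 'I_n.+1 * 'I_n.+1 -> K)
    (a : 'I_n.+1 * 'I_n.+1) : 1 - q * x != 0 ->
  \sum_b Rmat q x a.1 a.2 b.2 b.1 * f b = (1 - q * x)^-1 *
    (stay_num q x a.1 a.2 * f a + swap_num q x a.1 a.2 * f (a.2, a.1)).
Proof.
move=> qx.
pose g (b e : 'I_n.+1 * 'I_n.+1) (h : K) := if b == e then h else 0.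
transitivity (\sum_b (1 - q * x)^-1 *
    (g b a (stay_num q x a.1 a.2 * f a)
     + g b (a.2, a.1) (swap_num q x a.1 a.2 * f (a.2, a.1)))).
  apply: eq_bigr => -[b1 b2] _; rewrite RmatE //= -mulrA mulrDl; congr (_ * _).
  case: a => a1 a2; rewrite /g /= !xpair_eqE.
  congr (_ + _); case: andP => [[/eqP-> /eqP->]|_]; by rewrite ?mulr1 ?mulr0 ?mul0r.
rewrite -mulr_sumr big_split /=; congr (_ * (_ + _));
by rewrite -big_mkcond /= big_pred1_eq.
Qed.

Definition column_pair (K : fieldType) n (q s z z' : K) (m : 'I_n)
    (A C : vtuple n) (a b : 'I_n.+1 * 'I_n.+1) : K :=
  let B := vsub (vadd A a.1) b.1 in
  queue_weight q s z m.+1 A a.1 B b.1 * queue_weight q s z' m.+1 B a.2 C b.2.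

Lemma column_pairE (K : fieldType) n (q s z z' : K) (m : 'I_n) A C a b :
  column_tuple m A ->
  column_pair q s z z' m A C a b =
  (1 - s * z)^-1 * (1 - s * z')^-1 * pair_num q s z z' m A C a.1 a.2 b.1 b.2.
Proof.
move=> Ac; rewrite /column_pair /pair_num (queue_weightE _ _ _ _ Ac (leq_ord _) (leq_ord _)).
case: (eqVneq (queue_num q s z m A a.1 (vsub (vadd A a.1) b.1) b.1) 0) => [->|nz].
  by rewrite mulr0 !mul0r mulr0.
rewrite (queue_weightE _ _ _ _ (queue_num_column Ac nz) (leq_ord _) (leq_ord _)).
by rewrite mulrACA.
Qed.

(** The prefactors of the weights and the denominator [1 - q * x] are common to both sides, so the
    identity for numerators suffices. *)
Lemma column_yang_baxter (K : fieldType) n (q s x z : K) (m : 'I_n) A C a c :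
  column_tuple m A -> 1 - q * x != 0 ->
  \sum_b column_pair q s (x * z) z m A C a b * Rmat q x b.1 b.2 c.2 c.1
  = \sum_b Rmat q x a.1 a.2 b.2 b.1 * column_pair q s z (x * z) m A C b c.
Proof.
move=> Ac qx; rewrite Rmat_suml // Rmat_sumr // !column_pairE //=.
have YB := @pair_num_yang_baxter _ _ q s x z _ _ C _ _ _ _ Ac
  (leq_ord a.1) (leq_ord a.2) (leq_ord c.1) (leq_ord c.2).
congr (_ * _); move: YB.
set n1 := pair_num _ _ _ _ _ _ _ _ _ _ _; set n2 := pair_num _ _ _ _ _ _ _ _ _ _ _.
set n3 := pair_num _ _ _ _ _ _ _ _ _ _ _; set n4 := pair_num _ _ _ _ _ _ _ _ _ _ _.
set u := (1 - _)^-1; set v := (1 - _)^-1 => YB.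
transitivity (u * v * (n1 * stay_num q x c.1 c.2 + n2 * swap_num q x c.2 c.1)).
  by ring.
by rewrite YB; ring.
Qed.

(** * Moving the R-matrix through the columns *)

(** Entry [a] of the product of transfer matrices [V (n-1) ... V 0] applied to [g], expanded over
    paths so as to match sums over configurations. *)
Definition path_sum (K : pzRingType) (P : finType) n (V : 'I_n -> P -> P -> K)
    (a : P) (g : P -> K) : K :=
  \sum_(x : {ffun 'I_n.+1 -> P} | x ord_max == a)
    (\prod_(m < n) V m (x (lift ord0 m)) (x (widen_ord (leqnSn n) m))) * g (x ord0).

Lemma path_sum0 (K : pzRingType) (P : finType) (V : 'I_0 -> P -> P -> K) a g :
  path_sum V a g = g a.
Proof.
rewrite /path_sum (big_pred1 [ffun=> a]) => [|x].
  by rewrite big_ord0 mul1r ffunE.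
apply/eqP/eqP => [xa|->]; last by rewrite ffunE.
by apply/ffunP => i; rewrite ffunE -xa ord1 (ord1 ord_max).
Qed.

(** Absorbs column 0, the rightmost one, into [g]: it is the first column met by an R-matrix coming
    from the right boundary. *)
Lemma path_sumS (K : comPzRingType) (P : finType) n (V : 'I_n.+1 -> P -> P -> K) a g :
  path_sum V a g =
  path_sum (fun m => V (lift ord0 m)) a (fun b => \sum_p V ord0 b p * g p).
Proof.
pose join (yp : {ffun 'I_n.+1 -> P} * P) : {ffun 'I_n.+2 -> P} :=
  [ffun i => if unlift ord0 i is Some i' then yp.1 i' else yp.2].
pose split (x : {ffun 'I_n.+2 -> P}) := ([ffun i => x (lift ord0 i)], x ord0).
have joinK : cancel join split.
  case=> y p; rewrite /join /split; congr (_, _); last by rewrite ffunE unlift_none.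
  by apply/ffunP => i; rewrite !ffunE liftK.
have splitK : cancel split join.
  by move=> x; apply/ffunP => i; rewrite ffunE /=; case: unliftP => [j|] ->; rewrite ?ffunE.
rewrite /path_sum (reindex join) /=; last by exists split => ? _; rewrite ?joinK ?splitK.
under [RHS]eq_bigr do rewrite mulr_sumr.
rewrite pair_big_dep /=; apply: eq_big => [[y p]|[y p] _] /=.
  rewrite andbT; congr (_ == a).
  by rewrite /join ffunE (_ : ord_max = lift ord0 ord_max) ?liftK //; apply: val_inj.
have j0 : join (y, p) ord0 = p by rewrite ffunE unlift_none.
have jl i : join (y, p) (lift ord0 i) = y i by rewrite ffunE liftK.
rewrite big_ord_recl j0 jl.
rewrite (_ : widen_ord _ ord0 = ord0) ?j0; last exact: val_inj.
rewrite mulrAC mulrC; congr (_ * _); apply: eq_bigr => m _; rewrite !jl.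
rewrite (_ : widen_ord _ (lift ord0 m) = lift ord0 (widen_ord (leqnSn n) m)) ?jl //.
exact: val_inj.
Qed.

Lemma eq_path_sum (K : pzRingType) (P : finType) n (V : 'I_n -> P -> P -> K) a g g' :
  g =1 g' -> path_sum V a g = path_sum V a g'.
Proof. by move=> e; apply: eq_bigr => x _; rewrite e. Qed.

(** The train argument: [R] crosses the rightmost column by hypothesis, turning [V] into [V'] there,
    and the other columns by induction. *)
Lemma path_sum_train (K : comPzRingType) (P : finType) n
    (V V' : 'I_n -> P -> P -> K) (R : P -> P -> K) a g :
  (forall m b c, \sum_p V m b p * R p c = \sum_p R b p * V' m p c) ->
  path_sum V a (fun b => \sum_c R b c * g c)
  = \sum_b R a b * path_sum V' b g.
Proof.
elim: n V V' g => [|n IHn] V V' g VR.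
  by rewrite path_sum0; apply: eq_bigr => b _; rewrite path_sum0.
rewrite path_sumS; under [RHS]eq_bigr do rewrite path_sumS.
rewrite -(IHn (fun m => V (lift ord0 m))); last by move=> m; apply: VR.
apply: eq_path_sum => b.
under eq_bigr do rewrite mulr_sumr.
rewrite exchange_big /=.
under [RHS]eq_bigr do rewrite mulr_sumr.
rewrite [RHS]exchange_big; apply: eq_bigr => c _ /=.
under eq_bigr do rewrite mulrA.
under [RHS]eq_bigr do rewrite mulrA.
by rewrite -!mulr_suml VR.
Qed.

(** * Unordered sums *)

(** Unlike [summability.sum], which only names a limit, this asserts convergence. Over the complex
    numbers, [0 < e] makes [e] real. *)
Definition has_sum (K : numFieldType) (T : choiceType) (G : T -> K) (S : K) : Prop :=
  forall e : K, 0 < e -> exists J0 : {fset T}, forall J : {fset T},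
    (J0 `<=` J)%fset -> `|S - \sum_(i <- J) G i| < e.

Lemma has_sum_sum (K : numFieldType) (T : choiceType) (G : T -> K) (S : K) :
  has_sum G S -> summability.sum (G : T -> K^o) = S.
Proof.
move=> GS; have FF := @totally_filter T.
apply: (@cvg_lim K^o); first exact: norm_hausdorff.
apply/(@cvgrPdist_lt K K^o) => e e0; have [J0 HJ] := GS e e0.
by exists J0 => // J /= JJ; rewrite /partial_sum -(big_seq_fsetE _ J xpredT G) HJ.
Qed.

(** Agreement on a cofinal family of finite sets suffices, since both limits are approached on all
    large enough sets. *)
Lemma has_sum_frequently (K : numFieldType) (T : choiceType) (G H : T -> K) (S S' : K) :
  has_sum G S -> has_sum H S' ->
  (forall J : {fset T}, exists2 J' : {fset T}, (J `<=` J')%fset &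
    \sum_(i <- J') G i = \sum_(i <- J') H i) ->
  S = S'.
Proof.
move=> GS HS' GH; apply/eqP; rewrite -subr_eq0; apply: contraT => ne.
have e0 : 0 < `|S - S'| / 2 by rewrite divr_gt0 ?normr_gt0.
have [J1 H1] := GS _ e0; have [J2 H2] := HS' _ e0.
have [J' JJ' e] := GH (J1 `|` J2)%fset.
move: JJ'; rewrite fsubUset => /andP[/H1 + /H2]; rewrite e => h1 h2.
have := ltrD h1 h2; rewrite -splitr distrC => h.
suff : `|S - S'| < `|S - S'| by rewrite ltxx.
apply: le_lt_trans h; rewrite -[in X in X <= _](subrK (\sum_(i <- J') H i) S).
by rewrite -addrA addrC [X in _ <= X]addrC; apply: le_trans (ler_normD _ _) _;
  rewrite distrC [X in X + _]distrC.
Qed.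

Lemma has_sumD (K : numFieldType) (T : choiceType) (G H : T -> K) (S S' : K) :
  has_sum G S -> has_sum H S' -> has_sum (fun t => G t + H t) (S + S').
Proof.
move=> GS HS' e e0; have e2 : 0 < e / 2 by rewrite divr_gt0.
have [J1 H1] := GS _ e2; have [J2 H2] := HS' _ e2.
exists (J1 `|` J2)%fset => J; rewrite fsubUset => /andP[/H1 h1 /H2 h2].
rewrite big_split /= opprD addrACA (splitr e).
exact: le_lt_trans (ler_normD _ _) (ltrD h1 h2).
Qed.

Lemma has_sumZ (K : numFieldType) (T : choiceType) (G : T -> K) (a S : K) :
  has_sum G S -> has_sum (fun t => G t * a) (S * a).
Proof.
(* Adding 1 keeps the divisor positive when [a = 0]. *)
move=> GS e e0; have a0 : 0 < `|a| + 1 by rewrite ltr_wpDl.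
have [J0 H] := GS (e / (`|a| + 1)) (divr_gt0 e0 a0).
exists J0 => J /H; rewrite ltr_pdivlMr // => h.
rewrite -mulr_suml -mulrBl normrM; apply: le_lt_trans h.
by rewrite ler_wpM2l // ler_wpDr.
Qed.

Lemma eq_has_sum (K : numFieldType) (T : choiceType) (G H : T -> K) (S : K) :
  G =1 H -> has_sum G S -> has_sum H S.
Proof.
move=> GH GS e /GS[J0 HJ]; by exists J0 => J /HJ; rewrite (eq_bigr H).
Qed.

Lemma has_sum_cst0 (K : numFieldType) (T : choiceType) :
  has_sum (fun _ : T => 0 : K) 0.
Proof. by move=> e e0; exists fset0 => J _; rewrite big1 // subr0 normr0. Qed.

(** Convergence is asked only where the coefficient is nonzero, because it is established only for
    boundaries in which every color occurs. *)
Lemma has_sum_lincomb (K : numFieldType) (T : choiceType) (I : finType)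
    (G : I -> T -> K) (S a : I -> K) :
  (forall i, a i != 0 -> has_sum (G i) (S i)) ->
  has_sum (fun t => \sum_i G i t * a i) (\sum_i S i * a i).
Proof.
move=> GS; elim: (index_enum I) => [|i r IHr].
  apply: (eq_has_sum (G := fun=> 0)) => [t|]; first by rewrite big_nil.
  by rewrite big_nil; apply: has_sum_cst0.
apply: (eq_has_sum (G := fun t => G i t * a i + \sum_(j <- r) G j t * a j)) => [t|].
  by rewrite big_cons.
rewrite big_cons; apply: has_sumD => //.
have [a0|/GS] := eqVneq (a i) 0; last exact: has_sumZ.
rewrite a0 mulr0; apply: (eq_has_sum (G := fun=> 0)) => [t|]; last exact: has_sum_cst0.
by rewrite mulr0.
Qed.

Lemma nneg_has_sum (R : realType) (T : choiceType) (g : T -> R) (M : R) :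
  (forall t, 0 <= g t) -> (forall J : {fset T}, \sum_(i <- J) g i <= M) ->
  exists S, has_sum g S.
Proof.
move=> g0 gM; pose E := range (fun J : {fset T} => \sum_(i <- J) g i).
have supE : has_sup E.
  split; first by exists (\sum_(i <- fset0) g i); exists fset0.
  by exists M => _ [J _ <-].
exists (sup E) => e e0; have [_ [J0 _ <-] h] := sup_adherent e0 supE.
exists J0 => J JJ; have JE : \sum_(i <- J) g i <= sup E.
  by apply: sup_upper_bound => //; exists J.
rewrite ger0_norm ?subr_ge0 // ltrBlDr addrC -ltrBlDr; apply: lt_le_trans h _.
rewrite (big_fsetID _ (mem J0) J) /= (_ : [fset x | x in J & x \in J0] = J0)%fset.
  by rewrite lerDl sumr_ge0.
by apply/fsetP => x; rewrite !inE /=; apply: andb_idl; apply/fsubsetP.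
Qed.

(** [g] is the difference of [|g|] and [|g| - g], both nonnegative with bounded finite sums. *)
Lemma real_has_sum (R : realType) (T : choiceType) (g : T -> R) (M : R) :
  (forall J : {fset T}, \sum_(i <- J) `|g i| <= M) -> exists S, has_sum g S.
Proof.
move=> gM; have [S1 h1] := nneg_has_sum (fun t => normr_ge0 (g t)) gM.
have [t|J|S2 h2] := @nneg_has_sum _ _ (fun t => `|g t| - g t) (M + M).
- by rewrite subr_ge0 ler_norm.
- rewrite sumrB lerD //; apply: le_trans (gM J).
  by rewrite -sumrN; apply: ler_sum => i _; rewrite -normrN ler_norm.
exists (S1 + S2 * -1) => e e0; have [J0 H] := has_sumD h1 (has_sumZ (-1) h2) e0.
exists J0 => J /H; rewrite (eq_bigr g) // => i _.
by rewrite mulrN1 opprB addrC subrK.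
Qed.

Lemma complex_has_sum (R : realType) (T : choiceType) (G : T -> R[i]) (M : R) :
  (forall J : {fset T}, \sum_(i <- J) `|G i| <= M%:C) -> exists S, has_sum G S.
Proof.
move=> GM.
have part (p : R[i] -> R) : (forall x, `|p x|%:C <= `|x|) ->
    exists S, has_sum (fun t => p (G t)) S.
  move=> pn; apply: (@real_has_sum _ _ _ M) => J; rewrite -lecR.
  apply: le_trans (GM J); rewrite rmorph_sum /=; exact: ler_sum.
have [|S1 h1] := part (@complex.Re R); first exact: normc_ge_Re.
have [|S2 h2] := part (@complex.Im R).
  (* Multiplication by [-i] preserves the modulus and moves the imaginary part to the real part. *)
  move=> [x y]; have -> : `|x +i* y| = `|y -i* x|.
    by rewrite !normc_def /= sqrrN addrC.
  exact: (normc_ge_Re (y -i* x)).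
have liftC (g : T -> R) S : has_sum g S -> has_sum (fun t => (g t)%:C) S%:C.
  move=> gS e e0; have eR : e = (complex.Re e)%:C by rewrite RRe_real // gtr0_real.
  have [|J0 H] := gS (complex.Re e); first by rewrite -ltcR -eR.
  exists J0 => J /H; rewrite -rmorph_sum -rmorphB /= eR.
  by rewrite normc_def /= expr0n addr0 sqrtr_sqr ltcR.
exists (S1%:C + S2%:C * 'i%C) => e e0.
have [J0 H] := has_sumD (liftC _ _ h1) (has_sumZ 'i%C (liftC _ _ h2)) e0.
exists J0 => J /H; rewrite (eq_bigr G) // => t _.
by rewrite [RHS]complexE mulrC.
Qed.

(** * Exchange of two adjacent rows *)

(* G and H need only agree on the finite sums over the blocks
   [set fill t x | x : X], which partition their supports. *)
Lemma sum_blocks (K : nmodType) (T : choiceType) (X : finType) (pi : T -> T)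
    (fill : T -> X -> T) (G H : T -> K) :
  (forall t x, pi (fill t x) = pi t) -> (forall t x, fill (pi t) x = fill t x) ->
  (forall t, injective (fill t)) ->
  (forall t, G t != 0 -> exists x, t = fill t x) ->
  (forall t, H t != 0 -> exists x, t = fill t x) ->
  (forall t, \sum_x G (fill t x) = \sum_x H (fill t x)) ->
  forall J : {fset T}, exists2 J' : {fset T}, (J `<=` J')%fset &
    \sum_(i <- J') G i = \sum_(i <- J') H i.
Proof.
move=> pif fpi finj suppG suppH eqGH J.
pose block d : {fset T} := seq_fset tt [seq fill d x | x <- enum X].
have blockP d t : reflect (exists x, t = fill d x) (t \in block d).
  rewrite seq_fsetE; apply: (iffP mapP) => [[x _ ->]|[x ->]]; exists x => //.
  by rewrite mem_enum.
have sum_block (F : T -> K) d : \sum_(i <- block d) F i = \sum_x F (fill d x).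
  rewrite (perm_big [seq fill d x | x <- enum X]); last first.
    have u : uniq [seq fill d x | x <- enum X] by rewrite map_inj_uniq ?enum_uniq.
    by rewrite -[X in perm_eq _ X](undup_id u) seq_fset_perm.
  by rewrite big_map big_enum.
(* [J] is completed by the blocks of its elements. Blocks of distinct representatives are disjoint,
   and elements of [J] outside [U] contribute 0. *)
pose U := (\bigcup_(d <- [fset pi t | t in J]) block d)%fset.
exists (J `|` U)%fset; first exact: fsubsetUl.
have sumU (F : T -> K) : (forall t, F t != 0 -> exists x, t = fill t x) ->
    \sum_(i <- (J `|` U)%fset) F i =
    \sum_(d <- [fset pi t | t in J]%fset) \sum_x F (fill d x).
  move=> suppF; rewrite -(big_fset_incl _ (fsubsetUr J U)) => [|t].
    rewrite /U partition_disjoint_bigfcup => [|_ _ /imfsetP[t /= _ ->]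
      /imfsetP[t' /= _ ->] ne]; first by apply: eq_bigr => d _; apply: sum_block.
    apply/fdisjointP => _ /blockP[x ->]; apply/blockP => -[y].
    by rewrite !fpi => /(congr1 pi); rewrite !pif; apply/eqP.
  rewrite in_fsetU => tJU tU; apply/eqP; apply: contraNT tU => /suppF[x tx].
  have [tJ|//] := orP tJU.
  apply/bigfcupP; exists (pi t); first by rewrite andbT; apply/imfsetP; exists t.
  by apply/blockP; exists x; rewrite fpi.
by rewrite !sumU //; apply: eq_bigr => d _; apply: eqGH.
Qed.

Section RowExchange.

Variables (n N : nat) (j : 'I_N).
Hypothesis ord2 : ordS j != j.

Let P := ('I_n.+1 * 'I_n.+1)%type.

(** [x] prescribes the horizontal edges of two adjacent rows; the vertical states between them are
    recomputed by conservation. A block is thus finite although vertical states are unbounded. *)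
Definition rows_fill (c : config n N) (x : {ffun 'I_n.+1 -> P}) : config n N :=
  ([ffun p => if p.2 == j then (x p.1).1 else
              if p.2 == ordS j then (x p.1).2 else c.1 p],
   [ffun p => if p.2 == ordS j
              then vsub (vadd (c.2 (p.1, j)) (x (lift ord0 p.1)).1)
                        (x (widen_ord (leqnSn n) p.1)).1
              else c.2 p]).

Definition rows_erase (c : config n N) : config n N :=
  ([ffun p => if (p.2 == j) || (p.2 == ordS j) then ord0 else c.1 p],
   [ffun p => if p.2 == ordS j then [ffun=> None] else c.2 p]).

Lemma rows_fillh c x i : (rows_fill c x).1 (i, j) = (x i).1.
Proof. by rewrite ffunE /= eqxx. Qed.

Lemma rows_fillhS c x i : (rows_fill c x).1 (i, ordS j) = (x i).2.
Proof. by rewrite ffunE /= (negbTE ord2) eqxx. Qed.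

Lemma rows_fillh_out c x i r : r != j -> r != ordS j ->
  (rows_fill c x).1 (i, r) = c.1 (i, r).
Proof. by move=> rj rj1; rewrite ffunE /= (negbTE rj) (negbTE rj1). Qed.

Lemma rows_fillA c x m : (rows_fill c x).2 (m, ordS j) =
  vsub (vadd (c.2 (m, j)) (x (lift ord0 m)).1) (x (widen_ord (leqnSn n) m)).1.
Proof. by rewrite ffunE /= eqxx. Qed.

Lemma rows_fillA_out c x m r : r != ordS j -> (rows_fill c x).2 (m, r) = c.2 (m, r).
Proof. by move=> rj1; rewrite ffunE /= (negbTE rj1). Qed.

Lemma rows_erase_fill c x : rows_erase (rows_fill c x) = rows_erase c.
Proof.
rewrite /rows_erase; congr (_, _); apply/ffunP => -[i r]; rewrite !ffunE /=.
  by case: ifP => // /negbT; rewrite negb_or => /andP[/negbTE-> /negbTE->].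
by case: (eqVneq r (ordS j)).
Qed.

Lemma rows_fill_erase c x : rows_fill (rows_erase c) x = rows_fill c x.
Proof.
rewrite /rows_fill; congr (_, _); apply/ffunP => -[i r]; rewrite !ffunE /=.
  by have [|_] := eqVneq r j => //=; have [|_] := eqVneq r (ordS j).
by rewrite [j == _]eq_sym (negbTE ord2); have [|] := eqVneq r (ordS j).
Qed.

Lemma rows_fill_inj c : injective (rows_fill c).
Proof.
move=> x y e; apply/ffunP => i.
by rewrite [x i]surjective_pairing [y i]surjective_pairing
  -(rows_fillh c x) -(rows_fillh c y) -(rows_fillhS c x) -(rows_fillhS c y) e.
Qed.

Lemma rows_fill_support (K : fieldType) (q : K) s z (c : config n N) :
  config_weight q s z c != 0 -> exists x, c = rows_fill c x.
Proof.
move=> nz; exists [ffun i => (c.1 (i, j), c.1 (i, ordS j))].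
rewrite [LHS]surjective_pairing /rows_fill; congr (_, _); apply/ffunP => -[i r];
  rewrite !ffunE /=.
  by case: eqP => [->|_] //; case: eqP => [->|].
case: eqP => [->|//]; apply/eqP; move: nz; rewrite /config_weight.
rewrite (bigD1 i) //= mulf_eq0 negb_or (bigD1 j) //= mulf_eq0 negb_or.
case/andP => /andP[+ _] _; rewrite /queue_weight mulf_eq0 negb_or => /andP[_].
case: ifP => _; first by rewrite eqxx.
by case: ifP => [_|/negbFE -> //]; rewrite eqxx.
Qed.

Definition config_valid (c : config n N) : bool :=
  [forall r, c.1 (ord_max, r) == ord0]
  && [forall m : 'I_n, forall r : 'I_N, column_tuple m (c.2 (m, r))].

Definition config_boundary (c : config n N) : boundary n N := [ffun r => c.1 (ord0, r)].

Lemma admissibleE eta c :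
  admissible eta c = (config_boundary c == eta) && config_valid c.
Proof.
rewrite /admissible andbCA; congr (_ && _).
apply/forallP/eqP => [H|<- r]; last by rewrite ffunE.
by apply/ffunP => r; rewrite ffunE; apply/eqP.
Qed.

Definition outer_valid (c : config n N) : bool :=
  [forall r, (r != j) && (r != ordS j) ==> (c.1 (ord_max, r) == ord0)]
  && [forall m : 'I_n, forall r : 'I_N,
        (r != ordS j) ==> column_tuple m (c.2 (m, r))].

Definition outer_weight (K : fieldType) (q : K) (s : 'I_n -> K)
    (z : 'I_n -> 'I_N -> K) (c : config n N) : K :=
  \prod_(m < n) \prod_(r < N | (r != j) && (r != ordS j))
    queue_weight q (s m) (z m r) m.+1 (c.2 (m, r)) (c.1 (lift ord0 m, r))
      (c.2 (m, ordS r)) (c.1 (widen_ord (leqnSn n) m, r)).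

(** If [N = 2], then [ordS (ordS j)] is [j]; this is consistent, as only the states at [ordS j] vary
    within a block. *)
Definition rows_kernel (K : fieldType) (q : K) (s : 'I_n -> K)
    (z : 'I_n -> 'I_N -> K) (c : config n N) (m : 'I_n) : P -> P -> K :=
  column_pair q (s m) (z m j) (z m (ordS j)) m (c.2 (m, j)) (c.2 (m, ordS (ordS j))).

Let ordS2 : ordS (ordS j) != ordS j.
Proof. by rewrite (inj_eq (@ordS_inj N)). Qed.

Let jS : j != ordS j. Proof. by rewrite eq_sym. Qed.

(** The outer vertices do not see the middle states, since [ordS r = ordS j] forces [r = j]. *)
Lemma rows_fill_weight (K : fieldType) (q : K) s z c x :
  config_weight q s z (rows_fill c x) = outer_weight q s z c
  * \prod_(m < n) rows_kernel q s z c m (x (lift ord0 m)) (x (widen_ord (leqnSn n) m)).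
Proof.
rewrite /config_weight /outer_weight -big_split /=; apply: eq_bigr => m _.
rewrite (bigD1 j) //= (bigD1 (ordS j)) //= mulrA mulrC; congr (_ * _).
  apply: eq_bigr => r /andP[rj rj1]; rewrite !rows_fillh_out // !rows_fillA_out //.
  by rewrite (inj_eq (@ordS_inj N)).
rewrite !rows_fillh !rows_fillhS rows_fillA !rows_fillA_out //.
Qed.

Lemma queue_weight_column (K : fieldType) (q s z : K) (m : 'I_n) A (k : 'I_n.+1) B
    (l : 'I_n.+1) :
  column_tuple m A -> queue_weight q s z m.+1 A k B l != 0 -> column_tuple m B.
Proof.
move=> Ac; rewrite (queue_weightE _ _ _ _ Ac (leq_ord _) (leq_ord _)).
by rewrite mulf_eq0 negb_or => /andP[_]; apply: queue_num_column.
Qed.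

(** A nonzero weight makes the middle states column tuples automatically, so [x] is constrained only
    at the left edges. *)
Lemma rows_fill_valid (K : fieldType) (q : K) s z c x :
  (if config_valid (rows_fill c x) then config_weight q s z (rows_fill c x) else 0)
  = if outer_valid c && (x ord_max == (ord0, ord0))
    then config_weight q s z (rows_fill c x) else 0.
Proof.
have [->|nz] := eqVneq (config_weight q s z (rows_fill c x)) 0; first by rewrite !if_same.
suff -> : config_valid (rows_fill c x) = outer_valid c && (x ord_max == (ord0, ord0)) by [].
rewrite /config_valid /outer_valid andbAC; congr (_ && _).
  apply/forallP/andP => [H|[/forallP H /eqP xm] r].
    split; first apply/forallP => r.
      by apply/implyP => /andP[rj rj1]; have := H r; rewrite rows_fillh_out.
    have := H j; have := H (ordS j); rewrite rows_fillh rows_fillhS => /eqP h1 /eqP h2.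
    by rewrite [x _]surjective_pairing h1 h2.
  have [->|rj] := eqVneq r j; first by rewrite rows_fillh xm.
  have [->|rj1] := eqVneq r (ordS j); first by rewrite rows_fillhS xm.
  by rewrite rows_fillh_out //; have := H r; rewrite rj rj1.
apply: eq_forallb => m; apply/forallP/forallP => H r.
  by apply/implyP => rj1; have := H r; rewrite rows_fillA_out.
have [->|rj1] := eqVneq r (ordS j); last first.
  by rewrite rows_fillA_out //; have := H r; rewrite rj1.
move: nz; rewrite /config_weight (bigD1 m) //= mulf_eq0 negb_or (bigD1 j) //=.
rewrite mulf_eq0 negb_or => /andP[/andP[nz _] _].
apply: queue_weight_column nz; rewrite rows_fillA_out //.
by have := H j; rewrite jS.
Qed.

Lemma sum_rows_fill (K : fieldType) (q : K) s z c (g : boundary n N -> K) :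
  \sum_x (if config_valid (rows_fill c x) then config_weight q s z (rows_fill c x)
          else 0) * g (config_boundary (rows_fill c x))
  = if outer_valid c then outer_weight q s z c
      * path_sum (rows_kernel q s z c) (ord0, ord0)
          (fun b => g [ffun r => if r == j then b.1 else
                                 if r == ordS j then b.2 else c.1 (ord0, r)])
    else 0.
Proof.
transitivity (\sum_(x : {ffun 'I_n.+1 -> P} | x ord_max == (ord0, ord0))
   if outer_valid c then
     config_weight q s z (rows_fill c x) * g (config_boundary (rows_fill c x)) else 0).
  rewrite [RHS]big_mkcond; apply: eq_bigr => x _; rewrite rows_fill_valid.
  by case: ifP => [/andP[-> ->]//|]; case: (outer_valid c); case: (x _ == _) => //= _;
    rewrite mul0r.
case: ifP => _; last by rewrite big1.
rewrite /path_sum mulr_sumr; apply: eq_bigr => x _.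
rewrite rows_fill_weight mulrA; congr (_ * g _); apply/ffunP => r.
by rewrite !ffunE.
Qed.

Lemma RcheckE (K : fieldType) (q y : K) (eta eta' : boundary n N) :
  matelt (Rcheck n q y j (ordS j)) eta eta' =
  if [forall r, (r != j) && (r != ordS j) ==> (eta r == eta' r)]
  then Rmat q y (eta j) (eta (ordS j)) (eta' (ordS j)) (eta' j) else 0.
Proof. by rewrite /matelt mxE !enum_rankK. Qed.

(** After factoring out [outer_weight], both sides are path sums. The R-matrix travels from the
    right end to the left one, where it fixes [(ord0, ord0)]. *)
Lemma rows_exchange_block (K : fieldType) (q y : K) s
    (z z' : 'I_n -> 'I_N -> K) (eta' : boundary n N) c :
  1 - q * y != 0 ->
  (forall m, z m j = y * z m (ordS j)) ->
  (forall m, z' m j = z m (ordS j)) -> (forall m, z' m (ordS j) = z m j) ->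
  (forall m r, r != j -> r != ordS j -> z' m r = z m r) ->
  \sum_x (if config_valid (rows_fill c x) then config_weight q s z (rows_fill c x)
          else 0) * matelt (Rcheck n q y j (ordS j)) (config_boundary (rows_fill c x)) eta'
  = \sum_x (if config_valid (rows_fill c x) then config_weight q s z' (rows_fill c x)
          else 0) * (config_boundary (rows_fill c x) == eta')%:R.
Proof.
move=> qy zj z'j z'j1 z'r.
rewrite (sum_rows_fill q s z c (fun eta => matelt _ eta eta')).
rewrite (sum_rows_fill q s z' c (fun eta => (eta == eta')%:R)).
case: ifP => // /andP[_ /forallP cval].
have -> : outer_weight q s z' c = outer_weight q s z c.
  apply: eq_bigr => m _; apply: eq_bigr => r /andP[rj rj1].
  by rewrite z'r.
congr (_ * _).
pose agree := [forall r, (r != j) && (r != ordS j) ==> (c.1 (ord0, r) == eta' r)].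
pose e : P := (eta' j, eta' (ordS j)).
pose S (b c : P) := Rmat q y b.1 b.2 c.2 c.1.
pose g (b : P) : K := (agree && (b == e))%:R.
(* With [g] the indicator of the target boundary, the matrix element takes the form required by
   [path_sum_train]. *)
rewrite (@eq_path_sum _ _ _ _ _ _ (fun b => \sum_c S b c * g c)); last first.
  move=> b; rewrite RcheckE !ffunE eqxx (negbTE ord2) eqxx.
  have -> : [forall r, (r != j) && (r != ordS j) ==>
      ([ffun r0 => if r0 == j then b.1 else if r0 == ordS j then b.2
                   else c.1 (ord0, r0)] r == eta' r)] = agree.
    apply: eq_forallb => r; rewrite ffunE.
    by case: eqVneq => //= _; case: eqVneq.
  rewrite /g; case: ifP => _ /=; last by rewrite big1 // => ? _; rewrite mulr0.
  rewrite (bigD1 e) //= eqxx mulr1 big1 ?addr0 // => d /negbTE->.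
  by rewrite mulr0.
rewrite (path_sum_train (V' := rows_kernel q s z' c)); last first.
  move=> m b d; rewrite /rows_kernel z'j z'j1 zj; apply: column_yang_baxter => //.
  by have /forallP/(_ j) := cval m; rewrite jS.
rewrite (bigD1 (ord0, ord0)) //= /S /Rmat /= mul1r big1 ?addr0 => [|b].
  apply: eq_path_sum => b; congr (_%:R); congr (nat_of_bool _).
  apply/andP/eqP => [[/forallP ag /eqP ->]|ee].
    apply/ffunP => r; rewrite ffunE; case: eqVneq => [->//|rj].
    by case: eqVneq => [->//|rj1]; have := ag r; rewrite rj rj1 => /eqP.
  rewrite /agree /e -ee !ffunE eqxx (negbTE ord2) eqxx -surjective_pairing; split=> //.
  apply/forallP => r; rewrite ffunE; apply/implyP => /andP[/negbTE-> /negbTE->].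
  exact: eqxx.
case: b => b1 b2; rewrite xpair_eqE andbC /= => /negbTE->; exact: mul0r.
Qed.

Lemma rows_exchange (K : numFieldType) (q y : K) s (z z' : 'I_n -> 'I_N -> K)
    (eta' : boundary n N) (S : boundary n N -> K) (S' : K) :
  1 - q * y != 0 ->
  (forall m, z m j = y * z m (ordS j)) ->
  (forall m, z' m j = z m (ordS j)) -> (forall m, z' m (ordS j) = z m j) ->
  (forall m r, r != j -> r != ordS j -> z' m r = z m r) ->
  (forall eta, matelt (Rcheck n q y j (ordS j)) eta eta' != 0 ->
    has_sum (fun c => if admissible eta c then config_weight q s z c else 0) (S eta)) ->
  has_sum (fun c => if admissible eta' c then config_weight q s z' c else 0) S' ->
  \sum_eta S eta * matelt (Rcheck n q y j (ordS j)) eta eta' = S'.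
Proof.
move=> qy zj z'j z'j1 z'r /has_sum_lincomb sumL sumR.
apply: (has_sum_frequently sumL sumR).
(* A configuration has exactly one right boundary, so the sum over [eta] collapses to one series
   over configurations. *)
have term (w : 'I_n -> 'I_N -> K) (f : boundary n N -> K) c :
    \sum_eta (if admissible eta c then config_weight q s w c else 0) * f eta
    = (if config_valid c then config_weight q s w c else 0) * f (config_boundary c).
  rewrite (bigD1 (config_boundary c)) //= admissibleE eqxx /= big1 ?addr0 // => eta ne.
  by rewrite admissibleE eq_sym (negbTE ne) mul0r.
have supp w d : (if config_valid d then config_weight q s w d else 0) != 0 ->
    exists x, d = rows_fill d x.
  by case: ifP; rewrite ?eqxx // => _; apply: rows_fill_support.
have termR c : (if admissible eta' c then config_weight q s z' c else 0)
    = (if config_valid c then config_weight q s z' c else 0)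
      * (config_boundary c == eta')%:R.
  by rewrite admissibleE; case: eqP; case: config_valid; rewrite /= ?mulr1 ?mulr0.
apply: (sum_blocks rows_erase_fill rows_fill_erase rows_fill_inj) => c.
- by rewrite term mulf_eq0 negb_or => /andP[/supp].
- by rewrite termR mulf_eq0 negb_or => /andP[/supp].
- under eq_bigr do rewrite term; under [RHS]eq_bigr do rewrite termR.
  exact: rows_exchange_block.
Qed.

End RowExchange.

(** * Absolute convergence *)

Lemma tail_pow_bound (K : numDomainType) n (q : K) (m : 'I_n) A x :
  0 <= q <= 1 -> 0 <= tail_pow q m A x <= 1.
Proof.
move=> /andP[q0 q1]; rewrite /tail_pow; case: ifP; first by rewrite lexx ler01.
by rewrite exprn_ge0 // exprn_ile1.
Qed.

(** The term 1 covers [l = 0]; otherwise there are two tails of modulus at most 1, with coefficients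
    bounded by [|z| + |s|]. The bound is uniform in the vertical state. *)
Definition weight_bound (K : numFieldType) (s z : K) : K :=
  `|(1 - s * z)^-1| * (1 + `|s| * ((`|z| + `|s|) + (`|z| + `|s|))).

Lemma weight_bound_ge0 (K : numFieldType) (s z : K) : 0 <= weight_bound s z.
Proof. by rewrite mulr_ge0 // addr_ge0 // mulr_ge0 // !addr_ge0. Qed.

(** When the own color leaves, [T l = 0] and only [T l.+1] survives, which gives the power of
    [q]. *)
Lemma queue_weight_bound (K : numFieldType) n (q s z : K) (m : 'I_n) A
    (k : 'I_n.+1) B (l : 'I_n.+1) :
  0 <= q <= 1 -> column_tuple m A ->
  `|queue_weight q s z m.+1 A k B l| <=
  weight_bound s z * (if l == m.+1 :> nat then q ^+ vsum A m.+2 n else 1).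
Proof.
move=> q01 Ac; rewrite (queue_weightE _ _ _ _ Ac (leq_ord _) (leq_ord _)) normrM.
rewrite /weight_bound -mulrA ler_wpM2l //.
have /andP[q0 q1] := q01.
set e := (X in _ <= _ * X); have e0 : 0 <= e by rewrite /e; case: ifP; rewrite ?exprn_ge0.
have b0 : 0 <= `|z| + `|s| by rewrite addr_ge0.
rewrite /queue_num; case: ifP => _; last first.
  by rewrite normr0 mulr_ge0 // !addr_ge0 // mulr_ge0 // !addr_ge0.
rewrite /tail_num; case: eqP => [l0|_].
  rewrite /e l0 /= mulr1 normr1 lerDl mulr_ge0 //; exact: addr_ge0.
rewrite normrN normrM;
  apply: le_trans (_ : `|s| * ((`|z| + `|s|) * e + (`|z| + `|s|) * e) <= _).
  rewrite ler_wpM2l //; apply: le_trans (ler_normB _ _) _.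
  have T0 x : 0 <= tail_pow q m A x by case/andP: (tail_pow_bound m A x q01).
  have T1 x : tail_pow q m A x <= 1 by case/andP: (tail_pow_bound m A x q01).
  have coef (b : bool) : `|if b then z else s| <= `|z| + `|s|.
    by case: b; rewrite ?lerDl ?lerDr.
  rewrite !normrM !(ger0_norm (T0 _)); apply: lerD; apply: ler_pM => //.
    rewrite /e; case: eqP => [->|_] //.
    by rewrite /tail_pow ltnn.
  rewrite /e; case: eqP => [->|_] //.
  by rewrite /tail_pow leqnn exprn_ge0.
by rewrite -mulrDl mulrA ler_wpM2r // lerDr.
Qed.

Lemma ordS_ind N (Q : 'I_N -> Prop) (j0 : 'I_N) :
  Q j0 -> (forall j, Q j -> Q (ordS j)) -> forall j, Q j.
Proof.
move=> Q0 QS j.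
have Qiter t : Q (iter t (@ordS N) j0) by elim: t => //= t; apply: QS.
have valiter t : iter t (@ordS N) j0 = ((j0 + t) %% N)%N :> nat.
  elim: t => [|t IHt] /=; first by rewrite addn0 modn_small.
  by rewrite IHt -addn1 modnDml addn1 addnS.
(* From [j0], [N - j0] steps lead to 0 and [j] more to [j]. *)
suff -> : j = iter (N - j0 + j)%N (@ordS N) j0 by [].
apply: val_inj; rewrite /= valiter addnA subnKC ?modnDl ?modn_small //.
exact: ltnW.
Qed.

Lemma queue_weight_conserve (K : fieldType) n (q s z : K) (m : 'I_n) A
    (k : 'I_n.+1) B (l : 'I_n.+1) :
  column_tuple m A -> queue_weight q s z m.+1 A k B l != 0 ->
  vadd B l = vadd A k /\ B = vsub (vadd A k) l.
Proof.
move=> Ac; rewrite (queue_weightE _ _ _ _ Ac (leq_ord _) (leq_ord _)).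
rewrite mulf_eq0 negb_or /queue_num => /andP[_].
by case: ifP => [/andP[_ /eqP e] _|]; rewrite ?eqxx // -e vaddK.
Qed.

(** * Color flow in configurations of nonzero weight *)

Section NonzeroConfig.

Variables (K : fieldType) (n N : nat) (q : K) (s : 'I_n -> K)
  (z : 'I_n -> 'I_N -> K) (c : config n N).
Hypotheses (cval : config_valid c) (cnz : config_weight q s z c != 0).

Let colc m r : column_tuple m (c.2 (m, r)).
Proof. by have /andP[_ /forallP/(_ m)/forallP] := cval. Qed.

Let wnz m r : queue_weight q (s m) (z m r) m.+1 (c.2 (m, r)) (c.1 (lift ord0 m, r))
      (c.2 (m, ordS r)) (c.1 (widen_ord (leqnSn n) m, r)) != 0.
Proof.
by move/prodf_neq0: cnz => /(_ m isT)/prodf_neq0/(_ r isT).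
Qed.

(** Around the cylinder the finite coordinate [i] returns to its initial value, so column [m]
    absorbs color [i.+1] as often as it emits it. *)
Lemma color_count (m i : 'I_n) : i != m ->
  (\sum_(r < N) (i.+1 == c.1 (widen_ord (leqnSn n) m, r))
   = \sum_(r < N) (i.+1 == c.1 (lift ord0 m, r)))%N.
Proof.
move=> im; pose a r := odflt 0%N (c.2 (m, r) i).
apply: (@addIn (\sum_(r < N) a (ordS r))).
rewrite [in RHS](_ : \sum_(r < N) a (ordS r) = \sum_(r < N) a r)%N; last first.
  by rewrite -(reindex_inj (@ordS_inj N) (P := xpredT)).
rewrite -!big_split; apply: eq_bigr => r _; rewrite /a.
have [/ffunP/(_ i) + _] := queue_weight_conserve (colc m r) (wnz m r).
have fin r' : exists x, c.2 (m, r') i = Some x.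
  have /forallP/(_ i) := colc m r'; rewrite (negbTE im).
  by case: (c.2 (m, r') i) => [x|]; [exists x|case: ifP].
have [x ex] := fin r; have [y ey] := fin (ordS r).
rewrite !ffunE ex ey /=.
by case: (_ == _); case: (_ == _) => -[] /=; lia.
Qed.

(** The columns [k < m] preserve the number of edges of color [m.+1]. It is positive at the right
    boundary, hence also just to the right of column [m]. *)
Lemma exit_own_color (m : 'I_n) : all_colors (config_boundary c) ->
  exists r, c.1 (widen_ord (leqnSn n) m, r) == m.+1 :> nat.
Proof.
move=> /forallP/(_ m)/existsP[r0 /eqP]; rewrite ffunE => cr0.
have : forall k, (k <= m)%N ->
    (0 < \sum_(r < N) (m.+1 == c.1 (inord k, r)))%N.
  elim=> [_|k IHk km].
    rewrite (_ : inord 0 = ord0); last by apply: val_inj; rewrite /= inordK // ltnS ltnW.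
    by rewrite (bigD1 r0) //= cr0 /= eqxx.
  have kn : (k < n)%N by apply: leq_trans km (ltnW _).
  have := IHk (ltnW km).
  have := @color_count (Ordinal kn) m; rewrite -val_eqE /= gtn_eqF // => /(_ isT).
  rewrite (_ : widen_ord _ _ = inord k); last first.
    by apply: val_inj; rewrite /= inordK // ltnS ltnW.
  rewrite (_ : lift _ _ = inord k.+1); last first.
    by apply: val_inj; rewrite /= inordK // ltnS ltnW.
  by move=> ->.
move=> /(_ m (leqnn m)); rewrite (_ : inord m = widen_ord (leqnSn n) m); last first.
  by apply: val_inj; rewrite /= inordK // ltnS ltnW.
rewrite lt0n sum_nat_eq0 negb_forall => /existsP[r].
by rewrite eqb0 negbK eq_sym; exists r.
Qed.

End NonzeroConfig.

Definition exit_row n N (h : {ffun 'I_n.+1 * 'I_N -> 'I_n.+1}) (j0 : 'I_N) (m : 'I_n) : 'I_N :=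
  odflt j0 [pick r | h (widen_ord (leqnSn n) m, r) == m.+1 :> nat].

(* A configuration of nonzero weight is determined by its horizontal part and by
   one vertical state in each column; exit_row picks the state at a vertex where
   the column emits its own color, so that these numbers control the weight. *)
Definition config_code n N (j0 : 'I_N) (c : config n N) (p : 'I_n * 'I_n) : nat :=
  odflt 0%N (c.2 (p.1, exit_row c.1 j0 p.1) p.2).

(** At the exit row of each column the sharp bound supplies the powers of [q]; the uniform bound
    serves at the other rows. *)
Lemma config_weight_bound (K : numFieldType) n N (q : K) s z (j0 : 'I_N) (c : config n N) :
  0 <= q <= 1 -> all_colors (config_boundary c) -> config_valid c ->
  `|config_weight q s z c| <= (\prod_m \prod_r weight_bound (s m) (z m r))
     * \prod_p q ^+ config_code j0 c p.
Proof.
move=> q01 call cval; have /andP[q0 q1] := q01.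
have [->|cnz] := eqVneq (config_weight q s z c) 0.
  rewrite normr0 mulr_ge0 //; last by apply: prodr_ge0 => p _; rewrite exprn_ge0.
  by apply: prodr_ge0 => m _; apply: prodr_ge0 => r _; apply: weight_bound_ge0.
have colc m r : column_tuple m (c.2 (m, r)).
  by have /andP[_ /forallP/(_ m)/forallP] := cval.
rewrite -(pair_bigA _ (fun m i => q ^+ config_code j0 c (m, i))) /= -big_split /=.
rewrite normr_prod; apply: ler_prod => m _; rewrite normr_ge0 /=.
rewrite prodrXr normr_prod.
have [r1 er1] : exists2 r1, exit_row c.1 j0 m = r1 &
    c.1 (widen_ord (leqnSn n) m, r1) == m.+1 :> nat.
  exists (exit_row c.1 j0 m) => //; rewrite /exit_row; case: pickP => //= H.
  by have [r] := exit_own_color cval cnz m call; have /= -> := H r.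
move=> exit1.
(* Colors up to the own one contribute 0: their entries are [Some 0] or [None], and [odflt] sends
   [None] to 0. *)
have -> : (\sum_(i < n) config_code j0 c (m, i) = vsum (c.2 (m, r1)) m.+2 n)%N.
  rewrite /vsum [RHS]big_mkcond; apply: eq_bigr => i _; rewrite /config_code /= er1.
  rewrite ltn_ord andbT ltnS; have /column_tupleP[A0 Am _] := colc m r1.
  by case: (ltngtP m i) => // [/A0->|/val_inj <-] //; rewrite Am.
rewrite (bigD1 r1) //= [X in _ <= X * _](bigD1 r1) //= mulrAC.
apply: ler_pM => //.
- by rewrite prodr_ge0.
- by have := queue_weight_bound (s m) (z m r1) (c.1 (lift ord0 m, r1))
    (c.2 (m, ordS r1)) (c.1 (widen_ord (leqnSn n) m, r1)) q01 (colc m r1);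
  rewrite exit1.
apply: ler_prod => r _; rewrite normr_ge0 /=.
apply: le_trans (queue_weight_bound _ _ _ _ _ q01 (colc m r)) _.
rewrite ler_piMr ?weight_bound_ge0 //; case: ifP => // _.
by rewrite exprn_ile1.
Qed.

(** Equal horizontal parts give equal exit rows; the code fixes the states there, and conservation
    propagates them around the cylinder. *)
Lemma config_code_inj (K : fieldType) n N (q : K) s z (j0 : 'I_N) (c c' : config n N) :
  config_valid c -> config_valid c' ->
  config_weight q s z c != 0 -> config_weight q s z c' != 0 ->
  c.1 = c'.1 -> config_code j0 c =1 config_code j0 c' -> c = c'.
Proof.
move=> cval cval' nz nz' eh ecode.
rewrite [c]surjective_pairing [c']surjective_pairing eh; congr (_, _).
apply/ffunP => -[m r]; move: r.
apply: (@ordS_ind _ _ (exit_row c.1 j0 m)) => [|r er].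
  have col (d : config n N) : config_valid d -> forall r, column_tuple m (d.2 (m, r)).
    by move=> /andP[_ /forallP/(_ m)/forallP].
  have /column_tupleP[A0 Am Af] := col c cval (exit_row c.1 j0 m).
  have /column_tupleP[A0' Am' Af'] := col c' cval' (exit_row c.1 j0 m).
  apply/ffunP => i; case: (ltngtP i m) => [im|im|/val_inj->]; last by rewrite Am Am'.
    by rewrite A0 // A0'.
  have := ecode (m, i); rewrite /config_code /= -eh.
  have := Af i im; have := Af' i im; case: (c.2 _ i) => // a;
    by case: (c'.2 _ i) => //= b _ _ ->.
have step (d : config n N) : config_valid d -> config_weight q s z d != 0 ->
    d.2 (m, ordS r) = vsub (vadd (d.2 (m, r)) (d.1 (lift ord0 m, r)))
      (d.1 (widen_ord (leqnSn n) m, r)).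
  move=> /andP[_ /forallP/(_ m)/forallP/(_ r) dval].
  move=> /prodf_neq0 /(_ m isT)/prodf_neq0/(_ r isT).
  by case/(queue_weight_conserve dval).
by rewrite !step // er eh.
Qed.

Lemma geometric_bound (K : numFieldType) (q : K) B : 0 <= q < 1 ->
  \sum_(x < B) q ^+ x <= (1 - q)^-1.
Proof.
move=> /andP[q0 q1]; have q1' : 0 < 1 - q by rewrite subr_gt0.
rewrite -[leRHS]mul1r ler_pdivlMr // mulrC.
have -> : (1 - q) * \sum_(x < B) q ^+ x = 1 - q ^+ B.
  by rewrite -opprB mulNr -subrX1 opprB.
by rewrite gerBl exprn_ge0.
Qed.

Lemma ler_sum_code (K : numDomainType) (T : choiceType) (E : finType) (J : {fset T})
    (code : T -> E) (F : E -> K) :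
  {in J &, injective code} -> (forall e, 0 <= F e) ->
  \sum_(t <- J) F (code t) <= \sum_e F e.
Proof.
move=> inj F0; rewrite -(big_map code xpredT F) big_uniq; last first.
  by rewrite map_inj_in_uniq // fset_uniq.
by rewrite [leRHS](bigID [in map code J]) /= lerDl sumr_ge0.
Qed.

(** Nonzero configurations inject into pairs of a horizontal part and a code, so their sum is
    dominated by finitely many products of geometric series. *)
Lemma config_sum_bounded (K : numFieldType) n N (q : K) s z (j0 : 'I_N)
    (eta : boundary n N) : 0 <= q < 1 -> all_colors eta ->
  exists M : K, forall J : {fset config n N},
    \sum_(c <- J) `|if admissible eta c then config_weight q s z c else 0| <= M.
Proof.
move=> q01 call; have /andP[q0 q1] := q01.
pose W := \prod_m \prod_r weight_bound (s m) (z m r).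
have W0 : 0 <= W.
  by apply: prodr_ge0 => m _; apply: prodr_ge0 => r _; apply: weight_bound_ge0.
pose H : finType := {ffun 'I_n.+1 * 'I_N -> 'I_n.+1}.
exists (\sum_(h : H) W * \prod_(p : 'I_n * 'I_n) (1 - q)^-1) => J.
pose G c := if admissible eta c then config_weight q s z c else 0.
pose J1 := [fset c in J | G c != 0]%fset.
have GJ1 c : c \in J1 -> [/\ config_boundary c = eta, config_valid c
    & config_weight q s z c != 0].
  by rewrite !inE /= => /andP[_]; rewrite /G admissibleE; case: ifP;
    rewrite ?eqxx // => /andP[/eqP].
have -> : \sum_(c <- J) `|G c| = \sum_(c <- J1) `|G c|.
  apply/esym/big_fset_incl => [|c cJ].
    by apply/fsubsetP => c; rewrite !inE => /andP[].
  by rewrite !inE cJ /= negbK => /eqP->; rewrite normr0.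
(* [B] depends on [J] and only makes the codes a finite type; the final bound does not involve
   it. *)
pose B := \max_(c <- J1) \max_p config_code j0 c p.
have codeB c p : c \in J1 -> (config_code j0 c p < B.+1)%N.
  move=> cJ; rewrite ltnS /B; apply: leq_trans (leq_bigmax_seq _ cJ _) => //.
  exact: (leq_bigmax_cond (F := config_code j0 c)).
pose code (c : config n N) : H * {ffun 'I_n * 'I_n -> 'I_B.+1} :=
  (c.1, [ffun p => inord (config_code j0 c p)]).
pose F (e : H * {ffun 'I_n * 'I_n -> 'I_B.+1}) : K := W * \prod_p q ^+ e.2 p.
apply: le_trans (_ : \sum_(c <- J1) F (code c) <= _).
  rewrite big_seq [leRHS]big_seq; apply: ler_sum => c cJ; have [cb cv _] := GJ1 c cJ.
  rewrite /G admissibleE cb eqxx cv /=; have q01' : 0 <= q <= 1 by rewrite q0 ltW.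
  apply: le_trans (@config_weight_bound _ _ _ _ s z j0 _ q01' _ cv) _; rewrite ?cb //.
  rewrite /F /=; under [X in _ <= _ * X]eq_bigr do rewrite ffunE inordK ?codeB //.
  exact: lexx.
apply: le_trans (ler_sum_code _ _) _.
- move=> c c' cJ cJ' [eh /ffunP ecode].
  have [_ cv nz] := GJ1 c cJ; have [_ cv' nz'] := GJ1 c' cJ'.
  apply: (@config_code_inj _ _ _ _ _ _ j0 _ _ cv cv' nz nz' eh) => p.
  by have := ecode p; rewrite !ffunE => /(congr1 val) /=; rewrite !inordK ?codeB.
- by move=> e; rewrite mulr_ge0 // prodr_ge0 // => p _; rewrite exprn_ge0.
rewrite -(pair_bigA _ (fun h x => F (h, x))) /=; apply: ler_sum => h _.
rewrite -mulr_sumr ler_wpM2l //.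
rewrite -(bigA_distr_bigA (fun _ (x : 'I_B.+1) => q ^+ x)) /=.
apply: ler_prod => p _; rewrite geometric_bound // andbT.
by apply: sumr_ge0 => x _; rewrite exprn_ge0.
Qed.

Lemma cylinder_partition_has_sum (R : realType) n N (q : R) (s : 'I_n -> R[i])
    (z : 'I_n -> 'I_N -> R[i]) (j0 : 'I_N) (eta : boundary n N) :
  0 <= q < 1 -> all_colors eta ->
  has_sum (fun c => if admissible eta c then config_weight q%:C s z c else 0)
    (cylinder_partition q%:C s z eta).
Proof.
move=> q01 call; have q01C : 0 <= q%:C < 1 by rewrite ler0c -[1]/(1%:C) ltcR.
have [M HM] := config_sum_bounded s z j0 q01C call.
(* The empty sum gives [0 <= M], so [M] equals its real part, as needed for [complex_has_sum]. *)
have M0 : 0 <= M by have := HM fset0; rewrite big_seq_fset0.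
have [|S HS] := @complex_has_sum _ _
    (fun c => if admissible eta c then config_weight q%:C s z c else 0) (complex.Re M).
  by rewrite RRe_real // ger0_real.
by rewrite /cylinder_partition call (has_sum_sum HS).
Qed.

(** * The twisted cylinder *)

Lemma all_colors_perm n N (sigma : {perm 'I_N}) (eta eta' : boundary n N) :
  (forall r, eta' r = eta (sigma r)) -> all_colors eta' = all_colors eta.
Proof.
move=> e; apply: eq_forallb => i; apply/existsP/existsP => -[r /eqP er].
  by exists (sigma r); rewrite -e er.
by exists ((sigma^-1)%g r); rewrite e permKV er.
Qed.

(** A nonzero entry keeps or exchanges the two colors. Hence the value 0 assigned to boundaries
    missing a color is compatible with the exchange of rows. *)
Lemma Rcheck_all_colors (K : fieldType) n N (q y : K) (j : 'I_N) (eta eta' : boundary n N) :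
  ordS j != j -> matelt (Rcheck n q y j (ordS j)) eta eta' != 0 ->
  all_colors eta' = all_colors eta.
Proof.
move=> jS; rewrite RcheckE; case: ifP => [/forallP agree|]; last by rewrite eqxx.
have off r : r != j -> r != ordS j -> eta' r = eta r.
  by move=> rj rj1; have := agree r; rewrite rj rj1 => /eqP.
have stay : eta' j = eta j -> eta' (ordS j) = eta (ordS j) ->
    all_colors eta' = all_colors eta.
  move=> ej ej1; congr all_colors; apply/ffunP => r.
  have [->//|rj] := eqVneq r j; have [->//|rj1] := eqVneq r (ordS j); exact: off.
have swap : eta' j = eta (ordS j) -> eta' (ordS j) = eta j ->
    all_colors eta' = all_colors eta.
  move=> ej ej1; apply: (@all_colors_perm _ _ (tperm j (ordS j))) => r.
  have [->|rj] := eqVneq r j; first by rewrite tpermL.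
  have [->|rj1] := eqVneq r (ordS j); first by rewrite tpermR.
  by rewrite tpermD 1?eq_sym // off.
rewrite /Rmat; case: (eqVneq (eta j)) => [e|_].
  case: ifP => [/andP[/eqP h1 /eqP h2] _|_]; last by rewrite eqxx.
  by apply: stay; rewrite // h1 e.
case: ifP => [/andP[/eqP h1 /eqP h2] _|_]; first exact: swap.
case: ifP => [/andP[/eqP h1 /eqP h2] _|_]; last by rewrite eqxx.
exact: stay.
Qed.

Lemma cylinder_exchange (R : realType) n N (q : R) (y : R[i]) (s : 'I_n -> R[i])
    (z z' : 'I_n -> 'I_N -> R[i]) (j : 'I_N) (eta' : boundary n N) :
  0 <= q < 1 -> ordS j != j -> 1 - q%:C * y != 0 ->
  (forall m, z m j = y * z m (ordS j)) ->
  (forall m, z' m j = z m (ordS j)) -> (forall m, z' m (ordS j) = z m j) ->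
  (forall m r, r != j -> r != ordS j -> z' m r = z m r) ->
  \sum_eta cylinder_partition q%:C s z eta
    * matelt (Rcheck n q%:C y j (ordS j)) eta eta'
  = cylinder_partition q%:C s z' eta'.
Proof.
move=> q01 jS qy zj z'j z'j1 z'r.
have [call|ncall] := boolP (all_colors eta').
  apply: (rows_exchange jS qy zj z'j z'j1 z'r) => [eta nz|].
    by apply: cylinder_partition_has_sum => //; rewrite -(Rcheck_all_colors jS nz).
  exact: cylinder_partition_has_sum.
rewrite {2}/cylinder_partition (negbTE ncall) big1 // => eta _.
have [->|nz] := eqVneq (matelt (Rcheck n q%:C y j (ordS j)) eta eta') 0.
  exact: mulr0.
by rewrite /cylinder_partition -(Rcheck_all_colors jS nz) (negbTE ncall) mul0r.
Qed.

Lemma mulmx_matelt (K : fieldType) n N (F : boundary n N -> K) (M : tensor_op K n N) eta' :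
  ((\row_x F (enum_val x)) *m M) 0 (enum_rank eta')
  = \sum_eta F eta * matelt M eta eta'.
Proof.
rewrite mxE (reindex enum_rank) /=; last exact: onW_bij (enum_rank_bij _).
by apply: eq_bigr => eta _; rewrite mxE enum_rankK.
Qed.

(* After p factors the parameter u1 sits in row p + 1, cyclically. *)
Definition defect_spectral (K : fieldType) n N (u u1 : K) (x : 'I_n -> K) (p : nat)
    (m : 'I_n) (j : 'I_N) : K :=
  (if j == (p %% N)%N :> nat then u1 else u) * x m.

(** Lets [big_nat_recr] split off the last factor of an ordered product. *)
HB.instance Definition _ (K : pzRingType) k :=
  Monoid.isLaw.Build 'M[K]_k 1%:M (@mulmx K k k k)
    (@mulmxA K k k k k) (@mul1mx K k k) (@mulmx1 K k k).

(** The next factor acts on the row carrying [u1] and its successor carrying [u]; their ratio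
    [u1 / u] is the argument of the R-matrix. *)
Lemma twisted_prefix (R : realType) n N (q : R) (u u1 : R[i]) (s x : 'I_n -> R[i]) p :
  (0 < N)%N -> 0 <= q < 1 -> u != 0 -> 1 - q%:C * (u1 / u) != 0 -> (p <= N.+1)%N ->
  (\row_e cylinder_partition q%:C s (@defect_spectral _ n N.+1 u u1 x 0) (enum_val e))
    *m \big[mulmx/1%:M]_(0 <= i < p)
         Rcheck n q%:C (u1 / u) (inord i : 'I_N.+1) (ordS (inord i))
  = \row_e cylinder_partition q%:C s (@defect_spectral _ n N.+1 u u1 x p) (enum_val e).
Proof.
move=> N0 q01 u0 qy; elim: p => [_|p IHp pN].
  by rewrite big_geq // mulmx1.
have step (f : nat -> tensor_op R[i] n N.+1) :
    \big[mulmx/1%:M]_(0 <= i < p.+1) f i = (\big[mulmx/1%:M]_(0 <= i < p) f i) *m f p.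
  exact: big_nat_recr.
rewrite step mulmxA IHp; last exact: ltnW.
apply/rowP => e; rewrite -(enum_valK e) mulmx_matelt mxE enum_rankK.
set j : 'I_N.+1 := inord p.
have jp : j = p :> nat by rewrite /j inordK.
have jSp : ordS j = (p.+1 %% N.+1)%N :> nat by rewrite /= jp.
(* This includes the wraparound [p = N], where the successor is row 0 and [0 < N] is needed. *)
have pp : (p.+1 %% N.+1 != p)%N.
  move: pN; rewrite leq_eqVlt => /orP[/eqP[->]|pN]; last by rewrite modn_small // gtn_eqF.
  by rewrite modnn eq_sym -lt0n.
have pm : (p %% N.+1 = p)%N by rewrite modn_small.
apply: cylinder_exchange => //.
- by rewrite -val_eqE /= jp.
- by move=> m; rewrite /defect_spectral jSp jp pm eqxx (negbTE pp) mulrA divfK.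
- by move=> m; rewrite /defect_spectral jSp jp pm (negbTE pp) eq_sym (negbTE pp).
- by move=> m; rewrite /defect_spectral jSp jp pm !eqxx.
move=> m r rj rj1; rewrite /defect_spectral pm -jSp -jp.
by rewrite !val_eqE (negbTE rj) (negbTE rj1).
Qed.

Theorem theorem3p3 (R : realType) (n N : nat) (q : R) (u u1 : R[i])
    (v s : 'I_n -> R[i]) (z : 'I_n -> 'I_N -> R[i])
    (hn : (1 <= n)%N) (hN : (2 <= N)%N) (hq : 0 <= q < 1)
    (hv : forall m, v m != 0)
    (hz : twisted_spectral q u u1 v z)
    (hw : forall m j, 1 - s m * z m j != 0)
    (hu : u != 0) (hR : 1 - q%:C * (u1 / u) != 0)
    (eta' : boundary n N) :
  \sum_(eta : boundary n N)
     cylinder_partition q%:C s z eta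
     * matelt (twisted_cylinder n N q%:C u u1) eta eta'
  = cylinder_partition q%:C s z eta'.
Proof.
case: N hN z hz hw eta' => // N N0 z hz _ eta'.
have [x zx] : exists x : 'I_n -> R[i], forall m j, z m j = row_param u u1 j * x m.
  move: hz; rewrite /twisted_spectral; case: ifP => _; first exact: fin_all_exists.
  by move=> hz; exists (fun m => (v m * (Num.sqrt q)%:C)^-1).
have z0 : z = @defect_spectral _ n N.+1 u u1 x 0.
  by apply/funext => m; apply/funext => j; rewrite zx /defect_spectral mod0n.
(* After a full turn [N.+1] is 0 modulo [N.+1], so the final spectral parameters are the initial
   ones. *)
have zN : z = @defect_spectral _ n N.+1 u u1 x N.+1.
  by apply/funext => m; apply/funext => j; rewrite zx /defect_spectral modnn.
have /rowP/(_ (enum_rank eta')) :=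
  @twisted_prefix R n N q u u1 s x N.+1 N0 hq hu hR (leqnn _).
rewrite -z0 -zN big_mkord mulmx_matelt mxE enum_rankK => <-.
have -> // : twisted_cylinder n N.+1 q%:C u u1 =
  \big[mulmx/1%:M]_(i < N.+1) Rcheck n q%:C (u1 / u) (inord i) (ordS (inord i)).
by apply: eq_bigr => j _; rewrite inord_val.
Qed.
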